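(* Let $X$ be an infinite-dimensional complex Banach space and $T\in L(X)$. The following conditions are mutually equivalent: (i) there exists $(M,N)\in Red(T)$ such that $T_M$ is surjective and $T_N$ is meromorphic; (ii) $T$ admits a generalized Kato-meromorphic decomposition and $0\notin\mathrm{int}\,\sigma_{su}(T)$; (iii) $T$ admits a generalized Kato-meromorphic decomposition and $T'$ has the SVEP at $0$; (iv) $T$ admits a generalized Kato-meromorphic decomposition and $0\notin\mathrm{acc}\,\sigma_{B\mathcal B_-}(T)$; (v) $T$ admits a generalized Kato-meromorphic decomposition and $0\notin\mathrm{int}\,\sigma_{B\mathcal B_-}(T)$.
   Context: $L(X)$ is the algebra of bounded linear operators on $X$; $T'$ is the dual (adjoint) operator on $X'$; $N(T)$, $R(T)$ are kernel and range; $\sigma_{su}(T)=\{\lambda\in\mathbb C:T-\lambda I\text{ is not surjective}\}$ is the surjective spectrum; $\mathrm{int}\,K$ and $\mathrm{acc}\,K$ are the sets of interior and accumulation points of $K\subset\mathbb C$. $(M,N)\in Red(T)$ means that $M,N$ are closed $T$-invariant subspaces with $X=M\oplus N$; $T_M$, $T_N$ are the restrictions of $T$ viewed as operators on $M$, $N$. $T$ is Kato if $R(T)$ is closed and $N(T)\subset R(T^n)$ for every $n\in\mathbb N$. An operator is meromorphic if every non-zero point of its spectrum is a pole of its resolvent. $T$ admits a generalized Kato-meromorphic decomposition if there is $(M,N)\in Red(T)$ with $T_M$ Kato and $T_N$ meromorphic. $T$ is lower semi-Browder if it is lower semi-Fredholm (range of finite codimension) with finite descent. $T$ is lower semi-B-Browder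 if there is an integer $n\ge0$ such that $R(T^n)$ is closed and the restriction of $T$ to $R(T^n)$, viewed as a map $R(T^n)\to R(T^n)$, is lower semi-Browder; it is known that this is equivalent to right Drazin invertibility: the descent $\delta(T)$ is finite and $R(T^{\delta(T)})$ is closed. $\sigma_{B\mathcal B_-}(T)=\{\lambda\in\mathbb C:T-\lambda I\text{ is not lower semi-B-Browder}\}$. An operator $S$ on a Banach space $Y$ has the SVEP (single-valued extension property) at $\lambda_0\in\mathbb C$ if for every open disc $\mathcal D_{\lambda_0}$ centered at $\lambda_0$ the only analytic function $f:\mathcal D_{\lambda_0}\to Y$ satisfying $(S-\lambda)f(\lambda)=0$ for all $\lambda\in\mathcal D_{\lambda_0}$ is $f\equiv 0$. *)

(* Defs.v *)
From HB Require Import structures.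
From mathcomp Require Import all_boot all_order all_algebra.
From mathcomp Require Import complex.
From mathcomp Require Import boolp classical_sets functions reals topology.
From mathcomp Require Import normedtype sequences.

Set Implicit Arguments.
Unset Strict Implicit.
Unset Printing Implicit Defensive.
Import Order.TTheory GRing.Theory Num.Theory.
Import numFieldNormedType.Exports.
Local Open Scope classical_set_scope.
Local Open Scope ring_scope.
Local Open Scope complex_scope.

(* The complex field as a bundled numClosedFieldType, so that MathComp-Analysis
   equips it with its canonical norm and topology. *)
Definition Cplx (R : realType) : numClosedFieldType := R[i].

Section Subspace.
Context {K : numFieldType} {Y : normedModType K}.

(* A linear subspace M of Y, closed or not, as a normed space of its own. *)
Record subspace_of (M : submodClosed Y) :=
  Subspace { subspace_val :> Y; _ : subspace_val \in M }.

Variable M : submodClosed Y.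

HB.instance Definition _ := [isSub for @subspace_val M].
HB.instance Definition _ := [Choice of subspace_of M by <:].
HB.instance Definition _ := [SubChoice_isSubLmodule of subspace_of M by <:].

Let sub_norm (x : subspace_of M) : K := `|val x|.

Let sub_normD x y : sub_norm (x + y) <= sub_norm x + sub_norm y.
Proof. by rewrite /sub_norm raddfD ler_normD. Qed.

Let sub_normZ (l : K) x : sub_norm (l *: x) = `|l| * sub_norm x.
Proof. by rewrite /sub_norm linearZ /= normrZ. Qed.

Let sub_norm0_eq0 x : sub_norm x = 0 -> x = 0.
Proof. by move=> /normr0_eq0 h; apply: val_inj; rewrite raddf0. Qed.

HB.instance Definition _ :=
  Lmodule_isNormed.Build K (subspace_of M) sub_normD sub_normZ sub_norm0_eq0.

Lemma subspace_normE (x : subspace_of M) : `|x| = `|val x|.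
Proof. by []. Qed.

End Subspace.

Section Operators.
Context {R : realType}.
Notation C := (Cplx R).

Definition reC (c : C) : R := complex.Re c.

Lemma ge0_Re (c : C) : 0 <= c -> c = (reC c)%:C.
Proof. by rewrite lecE; case: (c : R[i]) => a b /= /andP[/eqP->]. Qed.

Lemma Re_norm_ge0 (V : normedModType C) (x : V) :
  0 <= reC `|x|.
Proof. by have := normr_ge0 x; rewrite lecE => /andP[]. Qed.

Section RealNorm.
Context {Y : normedModType C}.

Definition rnorm (x : Y) : R := reC `|x|.

Lemma rnormE x : `|x| = (rnorm x)%:C :> C.
Proof. exact/ge0_Re/normr_ge0. Qed.

Lemma rnorm_ge0 x : 0 <= rnorm x.
Proof. exact: Re_norm_ge0. Qed.

Lemma rnormD x y : rnorm (x + y) <= rnorm x + rnorm y.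
Proof. by rewrite -lecR rmorphD /= -!rnormE ler_normD. Qed.

Lemma rnormZ (l : C) x : rnorm (l *: x) = reC `|l| * rnorm x.
Proof.
have lE : `|l| = (reC `|l|)%:C by exact/ge0_Re/normr_ge0.
have := normrZ l x; rewrite (rnormE (l *: x)) (rnormE x) lE -rmorphM.
by move/complexI ->; rewrite -lE.
Qed.

Lemma rnorm_le1 x : (`|x| <= 1 :> C) = (rnorm x <= 1).
Proof. by rewrite rnormE -lecR. Qed.

Lemma rnorm0_eq0 x : rnorm x = 0 -> x = 0.
Proof. by move=> x0; apply/normr0_eq0; rewrite rnormE x0. Qed.

End RealNorm.

Section Space.
Context {Y Z : normedModType C}.

Definition bounded_op_pred : {pred Y -> Z} :=
  [pred f | `[< linear f /\ continuous f >]].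

Lemma bounded_op_submod_closed : submod_closed bounded_op_pred.
Proof.
split=> [|a f g /asboolP[lf cf] /asboolP[lg cg]]; apply/asboolP; split.
- by move=> a u v; rewrite /GRing.zero /= scaler0 addr0.
- exact: cst_continuous.
- move=> b u v; rewrite addrfctE scalrfctE /= lf lg !scalerDr !scalerA.
  by rewrite [a * b]mulrC addrACA.
- move=> x; apply: (@continuousD _ _ _ (a *: f) g); last exact: cg.
  exact/continuousZl_tmp/cf.
Qed.

HB.instance Definition _ :=
  GRing.isSubmodClosed.Build _ _ bounded_op_pred bounded_op_submod_closed.

End Space.

(* L(Y, Z): bounded (i.e. continuous) linear operators. *)
Record bounded_op (Y Z : normedModType C) :=
  BoundedOp { op_fun :> Y -> Z; _ : op_fun \in bounded_op_pred }.

Section Norm.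
Context {Y Z : normedModType C}.
Local Notation L := (bounded_op Y Z).
Implicit Types f g : L.

HB.instance Definition _ := [isSub for @op_fun Y Z].
HB.instance Definition _ := [Choice of L by <:].
HB.instance Definition _ := [SubChoice_isSubLmodule of L by <:].

Lemma op_linear (f : L) : linear f.
Proof. by case: f => f /= /asboolP[]. Qed.

HB.instance Definition _ (f : L) :=
  GRing.isLinear.Build C Y Z *:%R (op_fun f) (op_linear f).

Lemma op_continuous (f : L) : continuous f.
Proof. by case: f => f /= /asboolP[]. Qed.

Lemma opP (f g : L) : (forall x, f x = g x) -> f = g.
Proof. by move=> fg; apply/val_inj/funext. Qed.

(* The supremum is taken in R: an unbounded set would make it 0, but the set
   is bounded and contains 0 (has_sup_op_norm). *)
Definition op_norm (f : L) : R :=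
  sup [set rnorm (f x) | x in [set x | `|x| <= 1]].

Lemma op_bounded (f : L) :
  exists2 c : R, 0 <= c & forall x, rnorm (f x) <= c * rnorm x.
Proof.
have /linear_boundedP/pinfty_ex_gt0[c c0 fc] :
  bounded_near f (nbhs 0) by exact/linear_bounded_continuous/op_continuous.
have cE : c = (reC c)%:C.
  by move: c0; rewrite ltcE; case: (c : R[i]) => a b /= /andP[/eqP->].
exists (reC c).
  by move/ltW : c0; rewrite lecE => /andP[].
by move=> x; have := fc x; rewrite !rnormE [c in c * _]cE -rmorphM lecR.
Qed.

Lemma has_sup_op_norm (f : L) :
  has_sup [set rnorm (f x) | x in [set x | `|x| <= 1]].
Proof.
split; first by exists (rnorm (f 0)), 0 => //=; rewrite normr0 ler01.
have [c c0 fc] := op_bounded f; exists c => _ [x /= x1 <-].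
apply: (le_trans (fc x)); rewrite -[leRHS]mulr1 ler_wpM2l //.
by rewrite -rnorm_le1.
Qed.

Lemma op_norm_ge0 f : 0 <= op_norm f.
Proof.
apply: le_trans (rnorm_ge0 (f 0)) _.
apply: (ub_le_sup (proj2 (has_sup_op_norm f))).
by exists 0 => //=; rewrite normr0 ler01.
Qed.

Lemma rnorm_op f x : rnorm (f x) <= op_norm f * rnorm x.
Proof.
have [x0|x0] := eqVneq (rnorm x) 0.
  by rewrite x0 mulr0 (rnorm0_eq0 x0) linear0 /rnorm normr0.
have xp : 0 < rnorm x by rewrite lt_neqAle eq_sym x0 rnorm_ge0.
have nZ (V : normedModType C) (v : V) :
    rnorm ((((rnorm x)^-1)%:C : C) *: v) = (rnorm x)^-1 * rnorm v.
  rewrite rnormZ; congr (_ * _).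
  have -> : `|((rnorm x)^-1)%:C : R[i]| = ((rnorm x)^-1)%:C.
    by rewrite ger0_norm // ler0c invr_ge0 ltW.
  by [].
rewrite -ler_pdivrMr // mulrC -nZ -linearZ.
apply: (ub_le_sup (proj2 (has_sup_op_norm f))); eexists => //=.
by rewrite rnorm_le1 nZ mulVf.
Qed.

Lemma op_norm_le f (c : R) :
  (forall x, `|x| <= 1 -> rnorm (f x) <= c) -> op_norm f <= c.
Proof.
move=> fc; apply: sup_le_ub; first exact: (proj1 (has_sup_op_norm f)).
by move=> _ [x x1 <-]; exact: fc.
Qed.

Let norm (f : L) : C := (op_norm f)%:C.

Let normD f g : norm (f + g) <= norm f + norm g.
Proof.
rewrite /norm -rmorphD lecR; apply: op_norm_le => x x1.
apply: le_trans (rnormD (f x) (g x)) _.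
by apply: lerD; apply: (ub_le_sup (proj2 (has_sup_op_norm _))); exists x.
Qed.

Let op_normZ_le (l : C) f : op_norm (l *: f) <= reC `|l| * op_norm f.
Proof.
apply: op_norm_le => x x1.
have -> : (l *: f) x = l *: f x by [].
rewrite rnormZ ler_wpM2l ?(rnorm_ge0 (l : C)) //.
by apply: (ub_le_sup (proj2 (has_sup_op_norm _))); exists x.
Qed.

Let normZ (l : C) f : norm (l *: f) = `|l| * norm f.
Proof.
have lE (c : C) : `|c| = (reC `|c|)%:C by exact/ge0_Re.
rewrite lE /norm -rmorphM; congr (_%:C).
have [->|l0] := eqVneq l 0.
  by apply/eqP; rewrite eq_le op_normZ_le normr0 mul0r op_norm_ge0.
have lV : reC `|l| * reC `|l^-1| = 1.
  have : `|l| * `|l^-1| = 1 by rewrite -normrM mulfV // normr1.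
  by rewrite [in X in X -> _]lE [`|l^-1|]lE -rmorphM => /complexI.
apply/eqP; rewrite eq_le op_normZ_le /=.
rewrite -[f in leLHS](scalerK l0).
apply: le_trans (ler_wpM2l (Re_norm_ge0 (l : C)) (op_normZ_le _ _)) _.
by rewrite mulrA lV mul1r.
Qed.

Let norm0_eq0 f : norm f = 0 -> f = 0.
Proof.
move=> -[f0]; apply: opP => x; apply: rnorm0_eq0; apply/eqP.
by rewrite eq_le rnorm_ge0 (le_trans (rnorm_op f x)) // f0 mul0r.
Qed.

HB.instance Definition _ :=
  Lmodule_isNormed.Build C L normD normZ norm0_eq0.

Lemma op_normE (f : L) : `|f| = (op_norm f)%:C :> C.
Proof. by []. Qed.

End Norm.

Lemma bounded_opP (Y Z : normedModType C) (f : Y -> Z) (c : R) :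
  linear f -> (forall x, rnorm (f x) <= c * rnorm x) -> f \in bounded_op_pred.
Proof.
move=> lf fc; apply/asboolP; split=> //.
pose fl : {linear Y -> Z} :=
  HB.pack f (GRing.isLinear.Build C Y Z *:%R f lf).
apply: (@bounded_linear_continuous _ _ _ fl); apply/linear_boundedP.
exists c%:C; split; first by rewrite realE !lecE /= eqxx le_total.
move=> d cd x; apply: le_trans (ler_wpM2r (normr_ge0 x) (ltW cd)).
by rewrite !rnormE -rmorphM lecR fc.
Qed.

Section Algebra.
Context {X Y Z : normedModType C}.

Lemma op_comp_subproof (g : bounded_op Y Z) (f : bounded_op X Y) :
  (fun x => g (f x)) \in bounded_op_pred.
Proof.
apply/asboolP; split=> [a u v|x]; first by rewrite !linearP.
by apply: (@continuous_comp X Y Z f g x); exact: op_continuous.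
Qed.

Definition op_comp g f : bounded_op X Z := BoundedOp (op_comp_subproof g f).

Lemma op_id_subproof : (fun x : X => x) \in bounded_op_pred.
Proof. by apply/asboolP; split=> // x; exact: cvg_id. Qed.

Definition op_id : bounded_op X X := BoundedOp op_id_subproof.

End Algebra.

Definition op_exp (Y : normedModType C) (T : bounded_op Y Y) (n : nat) :
    bounded_op Y Y :=
  iter n (op_comp T) op_id.

Section Range.
Context {Y Z : normedModType C}.

Definition op_range (f : bounded_op Y Z) : {pred Z} := fun y => y \in range f.

Lemma op_range_submod_closed f : submod_closed (op_range f).
Proof.
split; first by apply/mem_set; exists 0; rewrite ?linear0.
move=> a _ _ /set_mem[u _ <-] /set_mem[v _ <-].
by apply/mem_set; exists (a *: u + v); rewrite ?linearP.
Qed.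

HB.instance Definition _ (f : bounded_op Y Z) :=
  GRing.isSubmodClosed.Build _ _ (op_range f) (op_range_submod_closed f).

End Range.

Section Restriction.
Context {Y : normedModType C}.

Definition invariant (T : bounded_op Y Y) (M : submodClosed Y) : Prop :=
  forall x, x \in M -> T x \in M.

Variables (T : bounded_op Y Y) (M : submodClosed Y) (TM : invariant T M).

Let restrict_fun (x : subspace_of M) : subspace_of M :=
  Subspace (TM (valP x)).

Lemma restrict_subproof : restrict_fun \in bounded_op_pred.
Proof.
have [c _ Tc] := op_bounded T.
apply: (@bounded_opP _ _ _ c) => [a u v|x]; last exact: Tc.
by apply: val_inj; rewrite /= linearP.
Qed.

(* T_M, as an operator on the normed space M. *)
Definition op_restrict : bounded_op (subspace_of M) (subspace_of M) :=
  BoundedOp restrict_subproof.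

End Restriction.

Lemma op_exp_range_invariant (Y : normedModType C) (T : bounded_op Y Y) n :
  invariant T (op_range (op_exp T n)).
Proof.
have expC x : T (op_exp T n x) = op_exp T n (T x).
  by elim: n => //= n IH; rewrite IH.
move=> _ /set_mem[x _ <-]; apply/mem_set; exists (T x) => //.
Qed.

Section Dual.
Context {X : normedModType C}.

Definition dual : normedModType C := bounded_op X C.

Variable T : bounded_op X X.

Let dual_fun (phi : bounded_op X C) : bounded_op X C := op_comp phi T.

Let dual_fun_linear : linear dual_fun.
Proof. by move=> a u v; apply: opP => x. Qed.

Let dual_fun_le phi : rnorm (dual_fun phi) <= op_norm T * rnorm phi.
Proof.
apply: op_norm_le => x; rewrite rnorm_le1 => x1.
apply: le_trans (rnorm_op phi (T x)) _; rewrite mulrC.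
apply: ler_wpM2r; first exact: op_norm_ge0.
by apply: le_trans (rnorm_op T x) _; rewrite ler_piMr // op_norm_ge0.
Qed.

Let dual_fun_bounded : dual_fun \in bounded_op_pred.
Proof. exact: bounded_opP dual_fun_linear dual_fun_le. Qed.

Definition dual_op : bounded_op dual dual := BoundedOp dual_fun_bounded.

End Dual.

Section Classes.
Context {Y : normedModType C}.
Implicit Types T : bounded_op Y Y.

Definition kernel T : set Y := [set x | T x = 0].

Definition surjective_op T : Prop := range T = setT.

Definition kato T : Prop :=
  closed (range T) /\ forall n, kernel T `<=` range (op_exp T n).

Definition is_inverse T S : Prop := op_comp T S = op_id /\ op_comp S T = op_id.

Definition spectrum T : set C :=
  [set l | ~ exists S, is_inverse (T - l *: op_id) S].

Definition surjective_spectrum T : set C :=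
  [set l | ~ surjective_op (T - l *: op_id)].

Definition finite_dim : Prop :=
  exists n (e : 'I_n -> Y), forall y, exists c : 'I_n -> C,
    y = \sum_i c i *: e i.

Definition finite_codim (W : set Y) : Prop :=
  exists n (e : 'I_n -> Y), forall y, exists c : 'I_n -> C,
    W (y - \sum_i c i *: e i).

Definition finite_descent T : Prop :=
  exists n, range (op_exp T n) = range (op_exp T n.+1).

(* Closedness of the range is not required: on a Banach space it follows from
   finite codimension. *)
Definition lower_semi_fredholm T : Prop := finite_codim (range T).

Definition lower_semi_browder T : Prop :=
  lower_semi_fredholm T /\ finite_descent T.

(* Analyticity is local expansion in a norm-convergent power series. *)
Definition analytic_at (Z : normedModType C) (f : C -> Z) (z0 : C) : Prop :=
  exists a : nat -> Z, \forall z \near z0,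
    series (fun n => (z - z0) ^+ n *: a n) @ \oo --> f z.

(* l0 is an isolated singularity of the resolvent, with a Laurent expansion
   that starts at the exponent - m. *)
Definition resolvent_pole T (l0 : C) : Prop :=
  exists m (g : C -> bounded_op Y Y),
    [/\ (0 < m)%N, analytic_at g l0, g l0 != 0 &
        \forall l \near l0^',
          is_inverse (T - l *: op_id) ((l - l0) ^- m *: g l)].

Definition meromorphic T : Prop :=
  forall l, l != 0 -> spectrum T l -> resolvent_pole T l.

Definition svep_at T (l0 : C) : Prop :=
  forall (r : C) (f : C -> Y), 0 < r ->
    (forall l, ball l0 r l -> analytic_at f l) ->
    (forall l, ball l0 r l -> (T - l *: op_id) (f l) = 0) ->
    forall l, ball l0 r l -> f l = 0.

(* (M, N) belongs to Red(T). *)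
Record reduces T (M N : submodClosed Y) : Prop := Reduces {
  red_closedl : closed [set` M];
  red_closedr : closed [set` N];
  red_invl : invariant T M;
  red_invr : invariant T N;
  red_sum : forall x, exists u v, [/\ u \in M, v \in N & x = u + v];
  red_cap : forall x, x \in M -> x \in N -> x = 0 }.

End Classes.

Definition lower_semi_b_browder (Y : normedModType C) (T : bounded_op Y Y) :
    Prop :=
  exists n, closed (range (op_exp T n)) /\
    lower_semi_browder (op_restrict (@op_exp_range_invariant Y T n)).

Definition lower_semi_b_browder_spectrum (Y : normedModType C)
    (T : bounded_op Y Y) : set C :=
  [set l | ~ lower_semi_b_browder (T - l *: op_id)].

Definition generalized_kato_meromorphic (Y : normedModType C)
    (T : bounded_op Y Y) : Prop :=
  exists (M N : submodClosed Y) (TMN : reduces T M N),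
    kato (op_restrict (red_invl TMN)) /\ meromorphic (op_restrict (red_invr TMN)).

End Operators.

Arguments finite_dim {R} Y.
Arguments dual {R} X.

(* Main.v *)
Require Import Defs.
From HB Require Import structures.
From mathcomp Require Import all_boot all_order all_algebra.
From mathcomp Require Import complex ring lra.
From mathcomp Require Import boolp classical_sets functions reals.
From mathcomp Require Import prodnormedzmodule topology normedtype sequences.

Set Implicit Arguments.
Unset Strict Implicit.
Unset Printing Implicit Defensive.
Import Order.TTheory GRing.Theory Num.Theory.
Import numFieldNormedType.Exports.
Local Open Scope classical_set_scope.
Local Open Scope ring_scope.
Local Open Scope complex_scope.

(* Write X = M + N with T_M Kato and T_N meromorphic. For l != 0 close to 0 the
   operator T_N - l is invertible or has a pole of its resolvent, hence is
   Drazin invertible, and T_M - l is surjective if T_M is; so (i) implies all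
   other conditions. Conversely, if T_M is Kato but not surjective, then a
   functional phi_0 != 0 annihilating the closed range of T_M is the start of a
   chain phi_(n+1) o T_M = phi_n of geometrically bounded functionals (open
   mapping and Hahn-Banach; N(T_M) is contained in R(T_M^n), so phi_n vanishes on
   N(T_M)). The sum F z of the series z^n phi_n, extended by 0 on N, is an
   analytic family of nonzero eigenvectors of T' near 0. It contradicts the SVEP
   of T' at 0 and forces T - l to have infinite descent for all small l, which
   contradicts (ii), (iv) and (v). *)

(** * Real-valued norms *)

(** The poles of the resolvent of T_N may accumulate at 0, so even for surjective T_M the operator T
    - l need not be surjective on any punctured disc about 0. Each small exceptional l != 0 is
    isolated, however. Hence a disc about 0 is left out of the surjective spectrum at some point
    reached in two moves, from 0 to l and from l to a neighbour, and the SVEP of T' follows by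
    applying the identity principle at every exception and then at 0. For the accumulation points of
    the B-Browder spectrum isolation is too weak; there every exception is removed, because the
    constant Laurent coefficient of the resolvent of T_N at a pole is a commuting inverse of T_N - l
    up to a power. In the converse direction finite descent serves as the common consequence of
    surjectivity and of being lower semi-B-Browder. A single eigenfunctional of T' at l does not
    exclude finite descent (take T = l); the analytic family of them around l does. *)

Definition toC (R : realType) (r : R) : Cplx R := r%:C.

Section Norms.
Context {R : realType}.
Notation C := (Cplx R).
Implicit Types (V W : normedModType C) (r : R) (z : C).

Lemma normC_rnorm V (x : V) : `|x| = toC (rnorm x).
Proof. exact: rnormE. Qed.

Lemma ltCR r s : (toC r < toC s) = (r < s).
Proof. exact: ltcR. Qed.

Lemma leCR r s : (toC r <= toC s) = (r <= s).
Proof. exact: lecR. Qed.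

Lemma toC_gt0 r : (0 < toC r) = (0 < r).
Proof. exact: ltcR. Qed.

Lemma toCM r s : toC (r * s) = toC r * toC s.
Proof. exact: (rmorphM (real_complex R)). Qed.

Lemma toCD r s : toC (r + s) = toC r + toC s.
Proof. exact: (rmorphD (real_complex R)). Qed.

Lemma toCN r : toC (- r) = - toC r.
Proof. exact: (rmorphN (real_complex R)). Qed.

Lemma toC1 : toC 1 = 1 :> C.
Proof. by []. Qed.

Lemma toC0 : toC 0 = 0 :> C.
Proof. by []. Qed.

Lemma toC_inj : injective (@toC R).
Proof. by move=> r s [->]. Qed.

Lemma gt0_toC z : 0 < z -> z = toC (reC z) /\ 0 < reC z.
Proof.
move=> z0; have zE : z = toC (reC z) by apply/ge0_Re/ltW.
by split=> //; rewrite -toC_gt0 -zE.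
Qed.

Lemma rnorm_scale V z (x : V) : rnorm (z *: x) = rnorm z * rnorm x.
Proof. exact: rnormZ. Qed.

Lemma rnormM (z w : C) : rnorm (z * w) = rnorm z * rnorm w.
Proof. exact: (rnorm_scale z w). Qed.

Lemma rnorm_toC r : rnorm (toC r) = `|r|.
Proof.
apply: toC_inj; rewrite -normC_rnorm.
have [r0|/ltW r0] := leP 0 r; first by rewrite !ger0_norm // lecR.
by rewrite !ler0_norm //= -?toCN // lecR.
Qed.

Lemma rnorm0 V : rnorm (0 : V) = 0.
Proof. by rewrite /rnorm normr0. Qed.

Lemma rnormN V (x : V) : rnorm (- x) = rnorm x.
Proof. by rewrite /rnorm normrN. Qed.

Lemma rnormC V (x y : V) : rnorm (x - y) = rnorm (y - x).
Proof. by rewrite -rnormN opprB. Qed.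

Lemma rnormB V (x y : V) : rnorm (x - y) <= rnorm x + rnorm y.
Proof. by rewrite -(rnormN y) rnormD. Qed.

Lemma rnorm_tri V (y x z : V) : rnorm (x - z) <= rnorm (x - y) + rnorm (y - z).
Proof. by apply: le_trans (rnormD _ _); rewrite addrA subrK. Qed.

Lemma rnorm_gt0 V (x : V) : (0 < rnorm x) = (x != 0).
Proof.
rewrite lt_neqAle rnorm_ge0 andbT eq_sym; congr (~~ _).
by apply/eqP/eqP => [/rnorm0_eq0|->] //; exact: rnorm0.
Qed.

Lemma rnormX z n : rnorm (z ^+ n) = rnorm z ^+ n.
Proof.
elim: n => [|n IH]; last by rewrite !exprS rnormM IH.
by rewrite !expr0 -toC1 rnorm_toC normr1.
Qed.

Lemma rnormMn V (x : V) n : rnorm (x *+ n) = rnorm x *+ n.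
Proof.
apply: toC_inj; rewrite -normC_rnorm normrMn normC_rnorm.
exact/esym/(rmorphMn (real_complex R)).
Qed.

Lemma le_eps0 (a : R) : (forall e, 0 < e -> a <= e) -> a <= 0.
Proof. by move=> h; apply/ler_addgt0Pr => e e0; rewrite add0r; exact: h. Qed.

Lemma nbhs_rnorm V (x : V) (A : set V) :
  nbhs x A <-> exists2 r, 0 < r & forall y, rnorm (y - x) < r -> A y.
Proof.
split=> [/nbhs_ballP[e /= e0 h]|[r r0 h]].
  have [eE e0'] := gt0_toC e0; exists (reC e) => // y yx; apply: h.
  by rewrite -ball_normE /= normC_rnorm rnormC eE ltCR.
apply/nbhs_ballP; exists (toC r); first by rewrite /= toC_gt0.
move=> y; rewrite -ball_normE /= normC_rnorm ltCR rnormC; exact: h.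
Qed.

Lemma dnbhs_rnorm V (x : V) (A : set V) :
  (\forall y \near x^', A y) <->
  exists2 r, 0 < r & forall y, rnorm (y - x) < r -> y != x -> A y.
Proof.
split=> [/nbhs_rnorm[r r0 h]|[r r0 h]]; first by exists r.
by apply/nbhs_rnorm; exists r.
Qed.

Lemma ball_rnorm V (z : V) r w : ball z (toC r) w <-> rnorm (w - z) < r.
Proof. by rewrite -ball_normE /= normC_rnorm ltCR rnormC. Qed.

Lemma cvg_rnorm V (u : nat -> V) (l : V) :
  u @ \oo --> l <->
  forall e, 0 < e -> exists n0, forall n, (n0 <= n)%N -> rnorm (u n - l) < e.
Proof.
split=> [ul e e0|h].
  have : nbhs l [set y | rnorm (y - l) < e] by apply/nbhs_rnorm; exists e.
  by move/ul => [n0 _ h]; exists n0 => n /h.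
move=> A /nbhs_rnorm[e e0 hA]; have [n0 hn] := h _ e0.
by exists n0 => // n /= /hn; exact: hA.
Qed.

Lemma cvg_rnorm_le V (u : nat -> V) (l : V) (c : R) :
  u @ \oo --> l -> (forall n, rnorm (u n) <= c) -> rnorm l <= c.
Proof.
move=> /cvg_rnorm ul uc; apply/ler_addgt0Pr => e e0.
have [n0 /(_ n0 (leqnn _)) h] := ul _ e0.
apply: le_trans (lerD (uc n0) (ltW h)).
by rewrite rnormC; apply: le_trans (rnormD _ _); rewrite addrC subrK.
Qed.

Lemma cvg_rnorm_shift V (u : nat -> V) (l : V) k :
  u @ \oo --> l -> (fun n => u (n + k)%N) @ \oo --> l.
Proof.
move=> /cvg_rnorm ul; apply/cvg_rnorm => e /ul[n0 h].
by exists n0 => n n0n; apply/h/(leq_trans n0n)/leq_addr.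
Qed.

Lemma cvg_opbound V W (f : V -> W) (c : R) (u : nat -> V) (l : V) :
  (forall x y, rnorm (f x - f y) <= c * rnorm (x - y)) ->
  u @ \oo --> l -> (fun n => f (u n)) @ \oo --> f l.
Proof.
move=> fc /cvg_rnorm ul; apply/cvg_rnorm => e e0.
(* [c] may be 0 or negative, so a positive number above it is used as the divisor. *)
have c0 : 0 < `|c| + 1 by rewrite ltr_wpDl.
have [|n0 h] := ul (e / (`|c| + 1)); first by rewrite divr_gt0.
exists n0 => n /h; rewrite ltr_pdivlMr // => lt.
apply: le_lt_trans lt; apply: le_trans (fc _ _) _; rewrite mulrC.
by apply: ler_wpM2l; [exact: rnorm_ge0|rewrite (le_trans (ler_norm _)) ?lerDl].
Qed.

Lemma cvg_op V W (f : bounded_op V W) (u : nat -> V) (l : V) :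
  u @ \oo --> l -> (fun n => f (u n)) @ \oo --> f l.
Proof.
by apply: (@cvg_opbound _ _ _ (op_norm f)) => x y; rewrite -linearB rnorm_op.
Qed.

Lemma cvg_scale V (a : C) (u : nat -> V) (l : V) :
  u @ \oo --> l -> (fun n => a *: u n) @ \oo --> a *: l.
Proof.
apply: (@cvg_opbound _ _ (fun x => a *: x) (rnorm a)) => x y.
by rewrite -scalerBr rnorm_scale.
Qed.

Lemma cvg_add V (u v : nat -> V) (a b : V) :
  u @ \oo --> a -> v @ \oo --> b -> (fun n => u n + v n) @ \oo --> a + b.
Proof.
move=> /cvg_rnorm ua /cvg_rnorm vb; apply/cvg_rnorm => e e0.
have e2 : 0 < e / 2 by rewrite divr_gt0.
have [n1 h1] := ua _ e2; have [n2 h2] := vb _ e2.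
exists (maxn n1 n2) => n; rewrite geq_max => /andP[/h1 l1 /h2 l2].
rewrite opprD addrACA [e]splitr.
exact: le_lt_trans (rnormD _ _) (ltrD l1 l2).
Qed.

Lemma cvg_const V (a : V) : (fun=> a) @ \oo --> a.
Proof. by apply/cvg_rnorm => e e0; exists 0%N => n _; rewrite subrr rnorm0. Qed.

Lemma cvg_uniq V (u : nat -> V) (l l' : V) :
  u @ \oo --> l -> u @ \oo --> l' -> l = l'.
Proof.
move=> /(cvg_lim (@norm_hausdorff _ _)) <-.
by move=> /(cvg_lim (@norm_hausdorff _ _)) <-.
Qed.

Lemma seriesES V (u : nat -> V) n : series u n = \sum_(k < n) u k.
Proof. by rewrite /series /= big_mkord. Qed.

Lemma op_series V W (f : bounded_op V W) (u : nat -> V) (l : V) :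
  series u @ \oo --> l -> series (fun n => f (u n)) @ \oo --> f l.
Proof.
move=> /(@cvg_op _ _ f).
suff -> : (fun n => f (series u n)) = series (fun n => f (u n)) by [].
by apply/funext => n; rewrite !seriesES linear_sum.
Qed.

End Norms.

Arguments cvg_const {R V} a.
Arguments cvg_scale {R V} a {u l}.
Arguments cvg_op {R V W} f {u l}.
Arguments op_series {R V W} f {u l}.

(** * Completeness *)

Section Banach.
Context {R : realType}.
Notation C := (Cplx R).
Implicit Types (V W Y Z : normedModType C).

(* Completeness in the form in which it is used; as a proposition it applies
   to closed subspaces, products and operator spaces, which carry no
   completeNormedModType structure. *)
Definition banach V : Prop := forall (u : nat -> V) (c : R),
  (forall n, rnorm (u n) <= c / 2 ^+ n) -> exists s : V, series u @ \oo --> s.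

Lemma exp2_lt (c e : R) : 0 < e -> exists n, c / 2 ^+ n < e.
Proof.
move=> e0; exists (Num.bound (`|c| / e)).
have h : `|c| / e < 2 ^+ Num.bound (`|c| / e).
  apply: lt_trans (archi_boundP _) _; first by rewrite divr_ge0 // ltW.
  by rewrite -natrX ltr_nat ltn_expl.
rewrite ltr_pdivrMr ?exprn_gt0 // mulrC -ltr_pdivrMr //.
by apply: le_lt_trans h; rewrite ler_pM2r ?invr_gt0 // ler_norm.
Qed.

Section Fast.
Variables (V : normedModType C) (u : nat -> V) (c : R).
Hypothesis uc : forall n, rnorm (u n) <= c / 2 ^+ n.

Lemma fast_ge0 : 0 <= c.
Proof. by apply: le_trans (rnorm_ge0 (u 0)) _; rewrite -[c]divr1 -(expr0 2). Qed.

Lemma fast_tail m n : (m <= n)%N ->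
  rnorm (series u n - series u m) <= 2 * c / 2 ^+ m.
Proof.
move=> /subnKC <-; move: (n - m)%N => k {n}.
(* The induction on k needs the sharp form: 2c / 2^(m+k) is the sum of all c / 2^n with n >= m + k,
   the part of the geometric series not yet used. *)
suff : rnorm (series u (m + k)%N - series u m) <=
    2 * c / 2 ^+ m - 2 * c / 2 ^+ (m + k).
  move/le_trans; apply; rewrite gerBl mulr_ge0 ?invr_ge0 ?exprn_ge0 //.
  by rewrite mulr_ge0 // fast_ge0.
elim: k => [|k IH]; first by rewrite addn0 !subrr rnorm0.
have -> : series u (m + k.+1)%N - series u m =
    (series u (m + k)%N - series u m) + u (m + k)%N.
  by rewrite addnS !seriesES big_ord_recr /= addrAC.
apply: le_trans (rnormD _ _) _; apply: le_trans (lerD IH (uc _)) _.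
rewrite addnS [2 ^+ (_).+1]exprS invfM.
rewrite le_eqVlt; apply/orP; left; apply/eqP; field.
by rewrite -?natrX ?pnatr_eq0 -?lt0n ?expn_gt0.
Qed.

Lemma fast_lim_tail s m : series u @ \oo --> s ->
  rnorm (s - series u m) <= 2 * c / 2 ^+ m.
Proof.
move=> us; apply: (@cvg_rnorm_le _ _ (fun n => series u (n + m)%N - series u m)).
  by apply: cvg_add; [exact: cvg_rnorm_shift|exact: cvg_const].
by move=> n; apply: fast_tail; rewrite leq_addl.
Qed.

Lemma fast_lim_le s : series u @ \oo --> s -> rnorm s <= 2 * c.
Proof.
by move=> /(@fast_lim_tail _ 0); rewrite seriesES big_ord0 subr0 expr0 divr1.
Qed.

Lemma fast_cvg s :
  (forall m, rnorm (s - series u m) <= 2 * c / 2 ^+ m) -> series u @ \oo --> s.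
Proof.
move=> h; apply/cvg_rnorm => e e0; have [n0 lt] := exp2_lt (2 * c) e0.
exists n0 => n n0n; rewrite rnormC; apply: le_lt_trans (h n) _.
apply: le_lt_trans lt; apply: ler_wpM2l; first by rewrite mulr_ge0 // fast_ge0.
by rewrite lef_pV2 ?posrE ?exprn_gt0 // ler_eXn2l // ltr1n.
Qed.

End Fast.

Lemma complete_banach (X : completeNormedModType C) : banach X.
Proof.
move=> u c uc; apply/cvg_ex; apply: cauchy_cvg.
apply: cauchy_exP => e /gt0_toC[eE e0].
have [n0 lt] := exp2_lt (2 * c) e0.
exists (series u n0); exists n0 => // n /= n0n.
by rewrite eE; apply/ball_rnorm/(le_lt_trans _ lt)/(fast_tail uc).
Qed.

Lemma fast_cauchy V (x : nat -> V) (c : R) : banach V ->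
  (forall n, rnorm (x n.+1 - x n) <= c / 2 ^+ n) -> exists l : V, x @ \oo --> l.
Proof.
move=> bV xc; have [s us] := bV _ _ xc; exists (s + x 0%N).
suff xE : x = (fun n => series (fun n => x n.+1 - x n) n + x 0%N).
  have := cvg_add us (cvg_const (x 0%N)); move: (s + _) => l.
  by rewrite -xE.
apply/funext => n; rewrite seriesES.
elim: n => [|n IH]; first by rewrite big_ord0 add0r.
by rewrite big_ord_recr /= addrAC -IH subrKC.
Qed.

Lemma banach_closed V (M : submodClosed V) :
  banach V -> closed [set` M] -> banach (subspace_of M).
Proof.
move=> bV cM u c uc; have [s us] := bV (fun n => val (u n)) c uc.
have vS n : val (series u n) = series (fun k => val (u k)) n.
  by rewrite !seriesES raddf_sum.
have sM : s \in M.
  apply: (closed_cvg _ cM _ _ us).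
  by apply: nearW => n; rewrite -vS; exact: valP.
exists (Subspace sM); apply/cvg_rnorm => e /((cvg_rnorm _ _).1 us)[n0 h].
by exists n0 => n /h; rewrite -vS.
Qed.

Section Product.
Variables Y Z : normedModType C.
Implicit Types x : (Y * Z)%type.

Lemma rnorm_pair x : rnorm x = Num.max (rnorm x.1) (rnorm x.2).
Proof.
apply: toC_inj; rewrite -normC_rnorm.
rewrite prod_normE !normC_rnorm /Order.max ltCR.
by case: ifP.
Qed.

Lemma rnorm_fst x : rnorm x.1 <= rnorm x.
Proof. by rewrite rnorm_pair le_max lexx. Qed.

Lemma rnorm_snd x : rnorm x.2 <= rnorm x.
Proof. by rewrite rnorm_pair le_max lexx orbT. Qed.

Lemma rnorm_pair_le x : rnorm x <= rnorm x.1 + rnorm x.2.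
Proof. by rewrite rnorm_pair ge_max lerDl lerDr !rnorm_ge0. Qed.

Lemma banach_prod : banach Y -> banach Z -> banach (Y * Z)%type.
Proof.
move=> bY bZ u c uc.
have uc1 n : rnorm (u n).1 <= c / 2 ^+ n by apply: le_trans (rnorm_fst _) _.
have uc2 n : rnorm (u n).2 <= c / 2 ^+ n by apply: le_trans (rnorm_snd _) _.
have [y uy] := bY _ _ uc1; have [z uz] := bZ _ _ uc2.
exists (y, z); apply/cvg_rnorm => e e0.
have e2 : 0 < e / 2 by rewrite divr_gt0.
have [n1 h1] := (cvg_rnorm _ _).1 uy _ e2.
have [n2 h2] := (cvg_rnorm _ _).1 uz _ e2.
exists (maxn n1 n2) => n; rewrite geq_max => /andP[/h1 l1 /h2 l2].
apply: le_lt_trans (rnorm_pair_le _) _.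
rewrite [e]splitr; apply: ltrD; [move: l1|move: l2]; congr (rnorm _ < _) => /=.
  by rewrite !seriesES (raddf_sum (@fst Y Z)).
by rewrite !seriesES (raddf_sum (@snd Y Z)).
Qed.

End Product.

Lemma real_fast_cvg (u : nat -> R) (c : R) :
  (forall n, `|u n| <= c / 2 ^+ n) -> exists s : R, series u @ \oo --> s.
Proof.
move=> uc; apply/cvg_ex; apply: (@normed_cvg _ R^o).
apply: (series_le_cvg _ _ uc) => //.
  by move=> n; apply: le_trans (uc n).
have : `|2^-1 : R| < 1 by rewrite ger0_norm ?invr_ge0 // invf_lt1 ?ltr1n.
move=> /(@is_cvg_geometric_series _ c _).
suff -> : geometric c (2^-1 : R) = (fun n => c / 2 ^+ n) by [].
by apply/funext => n; rewrite /geometric /= exprVn.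
Qed.

Lemma banach_C : banach C.
Proof.
move=> u c uc.
have reP (z : C) : `|complex.Re z| <= rnorm z.
  by rewrite -leCR -normC_rnorm; exact: normc_ge_Re.
have imP (z : C) : `|complex.Im z| <= rnorm z.
  rewrite -leCR -normC_rnorm /toC normc_def lecR /=.
  by rewrite -sqrtr_sqr ler_wsqrtr // lerDr sqr_ge0.
have leP (z : C) : rnorm z <= `|complex.Re z| + `|complex.Im z|.
  case: z => a b /=; have -> : (a +i* b : C) = toC a + 'i * toC b :> C.
    by rewrite /toC; simpc.
  apply: le_trans (rnormD _ _) _; rewrite rnormM !rnorm_toC.
  suff -> : rnorm ('i : C) = 1 by rewrite mul1r.
  apply: toC_inj; rewrite -normC_rnorm.
  by rewrite /toC normc_def /= expr0n expr1n add0r sqrtr1.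
have reB (z w : C) : complex.Re (z - w) = complex.Re z - complex.Re w.
  by case: z => ? ?; case: w.
have imB (z w : C) : complex.Im (z - w) = complex.Im z - complex.Im w.
  by case: z => ? ?; case: w.
have reS n : complex.Re (series u n) = series (fun n => complex.Re (u n)) n.
  rewrite /series /=; elim: n => [|n IH]; first by rewrite !big_geq.
  rewrite !big_nat_recr //= -IH -[in LHS](opprK (u n)).
  by rewrite reB -[- u n]sub0r reB sub0r opprK.
have imS n : complex.Im (series u n) = series (fun n => complex.Im (u n)) n.
  rewrite /series /=; elim: n => [|n IH]; first by rewrite !big_geq.
  rewrite !big_nat_recr //= -IH -[in LHS](opprK (u n)).
  by rewrite imB -[- u n]sub0r imB sub0r opprK.
have [a ua] := real_fast_cvg (fun n => le_trans (reP (u n)) (uc n)).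
have [b ub] := real_fast_cvg (fun n => le_trans (imP (u n)) (uc n)).
exists (a +i* b : C); apply/cvg_rnorm => e e0.
have e2 : 0 < e / 2 by rewrite divr_gt0.
have /cvgrPdist_lt/(_ _ e2)[n1 _ h1] := ua.
have /cvgrPdist_lt/(_ _ e2)[n2 _ h2] := ub.
exists (maxn n1 n2) => n; rewrite geq_max => /andP[/h1 l1 /h2 l2].
rewrite rnormC; apply: le_lt_trans (leP _) _; rewrite [e]splitr.
apply: ltrD; [move: l1|move: l2]; congr (`|_| < _).
  by rewrite reB reS.
by rewrite imB imS.
Qed.

Lemma op_norm_bound Y Z (f : bounded_op Y Z) (c : R) :
  0 <= c -> (forall x, rnorm (f x) <= c * rnorm x) -> rnorm f <= c.
Proof.
move=> c0 fc; apply: op_norm_le => x; rewrite rnorm_le1 => x1.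
by apply: le_trans (fc x) _; rewrite ler_piMr.
Qed.

Lemma op_sumE Y Z (u : nat -> bounded_op Y Z) n x :
  (\sum_(k < n) u k) x = \sum_(k < n) u k x.
Proof. by elim: n => [|n IH]; rewrite ?big_ord0 // !big_ord_recr /= -IH. Qed.

(** The sum is taken pointwise. The geometric tail bound at x is proportional to the norm of x with
    a constant independent of x, hence it bounds the tail in operator norm. *)
Lemma banach_op Y Z : banach Z -> banach (bounded_op Y Z).
Proof.
move=> bZ u c uc.
have ucx x n : rnorm (u n x) <= (c * rnorm x) / 2 ^+ n.
  apply: le_trans (rnorm_op _ _) _; rewrite mulrAC.
  by apply: ler_wpM2r; [exact: rnorm_ge0|exact: uc].
pose s x := projT1 (cid (bZ _ _ (ucx x))).
have sP x : series (fun n => u n x) @ \oo --> s x by rewrite /s; case: cid.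
have s_lin : linear s.
  move=> a x y; apply: cvg_uniq (sP _) _.
  suff -> : series (fun n => u n (a *: x + y)) = fun n =>
      a *: series (fun n => u n x) n + series (fun n => u n y) n.
    exact: cvg_add (cvg_scale a (sP x)) (sP y).
  apply/funext => n; rewrite !seriesES scaler_sumr -big_split /=.
  by apply: eq_bigr => k _; rewrite linearP.
have sb x : rnorm (s x) <= (2 * c) * rnorm x.
  by rewrite -mulrA; exact: fast_lim_le (ucx x) _ (sP x).
pose S : bounded_op Y Z := BoundedOp (bounded_opP s_lin sb).
exists S; apply: (fast_cvg uc) => m; apply: op_norm_bound => [|x].
  by rewrite !mulr_ge0 ?invr_ge0 ?exprn_ge0 // (fast_ge0 uc).
have -> : (S - series u m) x = s x - series (fun n => u n x) m.
  by rewrite !seriesES -op_sumE.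
by rewrite mulrAC -[2 * c * _]mulrA; exact: fast_lim_tail (ucx x) _ _ (sP x).
Qed.

End Banach.

(** * Open mapping theorem *)

Section OpenMapping.
Context {R : realType}.
Notation C := (Cplx R).
Variables (Y Z : normedModType C) (f : bounded_op Y Z).

(* The Baire argument: otherwise nested balls avoid the closures of the images
   of all balls of Y, and their common point has no preimage. *)
Lemma dense_image : banach Z -> (forall z, exists y, f y = z) ->
  exists (n : nat) (z0 : Z) (r : R), 0 < r /\
    forall w e, rnorm (w - z0) < r -> 0 < e ->
      exists2 y, rnorm y <= n%:R & rnorm (f y - w) < e.
Proof.
move=> bZ fs; apply: contrapT => H.
have step (x : nat * (Z * R)) : exists q : Z * R, 0 < x.2.2 ->
    [/\ 0 < q.2, q.2 <= x.2.2 / 2, rnorm (q.1 - x.2.1) <= x.2.2 / 2 &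
        forall y, rnorm y <= x.1%:R -> q.2 < rnorm (f y - q.1)].
  case: x => n [z r] /=; have [r0|_] := ltP 0 r; last by exists (z, r).
  apply: contrapT => N; apply: H; exists n, z, (r / 2); split.
    by rewrite divr_gt0.
  move=> w e wz e0; apply: contrapT => N'; apply: N.
  (* Radius e / 2 makes even the closed ball about w miss every [f y] with [rnorm y <= n%:R]; radius
     r / 2 keeps it inside the previous ball. *)
  exists (w, Num.min (e / 2) (r / 2)) => _; split => /=.
  - by rewrite lt_min !divr_gt0.
  - by rewrite ge_min lexx orbT.
  - exact: ltW.
  move=> y yn; rewrite gt_min; apply/orP; left.
  have ew : e <= rnorm (f y - w).
    by rewrite leNgt; apply/negP => lt; apply: N'; exists y.
  by apply: lt_le_trans ew; rewrite ltr_pdivrMr // ltr_pMr // ltr1n.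
have [g gP] := choice step.
pose p := fix p n := if n is k.+1 then g (k, p k) else (0 : Z, 1 : R).
have p0 n : 0 < (p n).2.
  by elim: n => [|n IH] //=; have [] := gP (n, p n) IH.
have pS n := gP (n, p n) (p0 n).
have r_le n : (p n).2 <= 1 / 2 ^+ n.
  elim: n => [|n IH]; first by rewrite expr0 divr1.
  have [_ h _ _] := pS n; apply: le_trans h _ => /=.
  by rewrite exprSr invfM mulrA ler_pM2r ?invr_gt0.
(* Nestedness of the balls: centres differ by at most the difference of the radii. *)
have dist n k : rnorm ((p (n + k)%N).1 - (p n).1) <= (p n).2 - (p (n + k)%N).2.
  elim: k => [|k IH]; first by rewrite addn0 !subrr rnorm0.
  have [_ h1 h2 _] := pS (n + k)%N; rewrite addnS.
  apply: le_trans (rnorm_tri (p (n + k)%N).1 _ _) _.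
  apply: le_trans (lerD h2 IH) _; move: h1 => /=; lra.
have [|z pz] := @fast_cauchy _ _ (fun n => (p n).1) 1 bZ.
  move=> n; have [_ _ h _] := pS n.
  apply: le_trans h _; apply: le_trans (r_le n).
  by have := p0 n; rewrite [(n, p n).2]/=; lra.
have zp n : rnorm (z - (p n).1) <= (p n).2.
  apply: (@cvg_rnorm_le _ _ (fun k => (p (k + n)%N).1 - (p n).1)).
    by apply: cvg_add (cvg_const _); exact: (cvg_rnorm_shift n pz).
  by move=> k; rewrite addnC; apply: le_trans (dist n k) _; rewrite gerBl ltW.
have [y fy] := fs z; have [_ _ _ /(_ y)] := pS (Num.bound (rnorm y)).
move=> /(_ (ltW (archi_boundP (rnorm_ge0 y)))) /=.
by rewrite fy ltNge; have := zp (Num.bound (rnorm y)).+1 => /= ->.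
Qed.

(** Density near z0 is moved to 0 by subtracting approximate preimages y1 of z0 + t w and y2 of z0.
    The scale t = r / (2 |w|) keeps z0 + t w in the ball; the two errors r / 8 add up to t |w| / 2,
    and |y1 - y2| <= 2n divided by t gives K = 4n / r. *)
Lemma approx_preimage : banach Z -> (forall z, exists y, f y = z) ->
  exists2 K, 0 <= K & forall w, exists y,
    rnorm y <= K * rnorm w /\ rnorm (w - f y) <= rnorm w / 2.
Proof.
move=> bZ fs; have [n [z0 [r [r0 h]]]] := dense_image bZ fs.
exists (4 * n%:R / r); first by rewrite !mulr_ge0 ?invr_ge0 // ltW.
move=> w; have [->|w0] := eqVneq w 0.
  by exists 0; rewrite linear0 subr0 !rnorm0 mulr0 mul0r.
have wp : 0 < rnorm w by rewrite rnorm_gt0.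
pose t := r / (2 * rnorm w).
have t0 : 0 < t by rewrite divr_gt0 // mulr_gt0.
have e0 : 0 < r / 8 by rewrite divr_gt0.
have [|y1 y1n h1] := h (z0 + toC t *: w) _ _ e0.
  rewrite addrAC subrr add0r rnorm_scale rnorm_toC gtr0_norm // /t.
  have -> : r / (2 * rnorm w) * rnorm w = r / 2 by field; rewrite gt_eqF.
  by rewrite ltr_pdivrMr // ltr_pMr // ltr1n.
have [|y2 y2n h2] := h z0 _ _ e0; first by rewrite subrr rnorm0.
have tV : rnorm (toC t^-1) = t^-1 by rewrite rnorm_toC gtr0_norm // invr_gt0.
exists (toC t^-1 *: (y1 - y2)); rewrite rnorm_scale tV; split.
  have -> : 4 * n%:R / r * rnorm w = t^-1 * (n%:R + n%:R).
    by rewrite /t; field; rewrite !gt_eqF.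
  rewrite ler_pM2l ?invr_gt0 //; apply: le_trans (rnormB _ _) _.
  exact: lerD.
have -> : w - f (toC t^-1 *: (y1 - y2)) =
    toC t^-1 *: (toC t *: w - (f y1 - f y2)).
  rewrite linearZ linearB scalerBr scalerA -toCM mulVf ?gt_eqF //.
  by rewrite toC1 scale1r.
rewrite rnorm_scale tV.
have -> : rnorm w / 2 = t^-1 * (r / 8 + r / 8).
  by rewrite /t; field; rewrite !gt_eqF.
rewrite ler_pM2l ?invr_gt0 //.
have -> : toC t *: w - (f y1 - f y2) =
    (f y2 - z0) - (f y1 - (z0 + toC t *: w)).

  by rewrite !opprB -[z0 + _ - _]addrA [RHS]addrA subrK addrCA.
apply: le_trans (rnormB _ _) _; apply: lerD; exact: ltW.
Qed.

(** Each approximate preimage halves the residual [v n], so the corrections [g (v n)] form a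
    geometrically bounded series that sums to an exact preimage. *)
Lemma open_mapping : banach Y -> banach Z -> (forall z, exists y, f y = z) ->
  exists2 c, 0 <= c & forall w, exists2 y, f y = w & rnorm y <= c * rnorm w.
Proof.
move=> bY bZ fs; have [K K0 /choice[g gP]] := approx_preimage bZ fs.
exists (2 * K) => [|w]; first by rewrite mulr_ge0.
pose v := fix v n := if n is k.+1 then v k - f (g (v k)) else w.
have v_le n : rnorm (v n) <= rnorm w / 2 ^+ n.
  elim: n => [|n IH]; first by rewrite expr0 divr1.
  have [_ h] := gP (v n); apply: le_trans h _.
  by rewrite exprSr invfM mulrA ler_pM2r ?invr_gt0.
have u_le n : rnorm (g (v n)) <= (K * rnorm w) / 2 ^+ n.
  have [h _] := gP (v n); apply: le_trans h _.
  by rewrite -mulrA ler_wpM2l.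
have [y uy] := bY _ _ u_le; exists y; last first.
  by rewrite -mulrA; exact: fast_lim_le u_le _ uy.
apply: cvg_uniq (op_series f uy) _.
suff -> : series (fun n => f (g (v n))) = fun n => w - v n.
  apply/cvg_rnorm => e e0; have [n0 lt] := exp2_lt (rnorm w) e0.
  exists n0 => n n0n; rewrite addrAC subrr add0r rnormN.
  apply: le_lt_trans (v_le n) _; apply: le_lt_trans lt; apply: ler_wpM2l.
    exact: rnorm_ge0.
  by rewrite lef_pV2 ?posrE ?exprn_gt0 // ler_eXn2l // ltr1n.
apply/funext => n; rewrite seriesES.
elim: n => [|n IH]; first by rewrite big_ord0 subrr.
by rewrite big_ord_recr /= IH opprB addrA addrAC.
Qed.

End OpenMapping.

(** A closed range is itself a Banach space, and f maps onto it, so the open mapping theorem applies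
    to the corestriction. *)
Lemma closed_range_lift (R : realType) (Y Z : normedModType (Cplx R))
    (f : bounded_op Y Z) : banach Y -> banach Z -> closed (range f) ->
  exists2 c, 0 <= c &
    forall x, exists2 y, f y = f x & rnorm y <= c * rnorm (f x).
Proof.
move=> bY bZ cf.
have fM x : f x \in op_range f by apply/mem_set; exists x.
pose g (x : Y) : subspace_of (op_range f) := Subspace (fM x).
have g_lin : linear g by move=> a x y; apply: val_inj; rewrite /= linearP.
have gb x : rnorm (g x) <= op_norm f * rnorm x := rnorm_op f x.
pose G : bounded_op Y (subspace_of (op_range f)) :=
  BoundedOp (bounded_opP g_lin gb).
have bS : banach (subspace_of (op_range f)).
  apply: banach_closed => //; suff -> : [set` op_range f] = range f by [].
  by apply/seteqP; split=> z /=; [move/set_mem|move/mem_set].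
have [|c c0 h] := @open_mapping _ _ _ G bY bS.
  by case=> z zf; have [x _ xz] := set_mem zf; exists x; apply: val_inj.
by exists c => // x; have [y [yx] le] := h (g x); exists y.
Qed.

(** * Hahn-Banach theorem *)

Section RealHahnBanach.
Context {R : realType}.
Notation C := (Cplx R).
Variables (V : normedModType C) (c : R).

(* A linear functional on a subspace is given by its graph, so that neither the
   subspace nor the function has to be named. *)
Let good (G : set (V * R)) : Prop :=
  (forall a u x v y, G (u, x) -> G (v, y) -> G (toC a *: u + v, a * x + y)) /\
  (forall u x, G (u, x) -> x <= c * rnorm u).

Let good0 G : good G -> G !=set0 -> G (0, 0).
Proof.
move=> [lG _] [[u x] Gu]; have := lG (-1) _ _ _ _ Gu Gu.
by rewrite toCN toC1 scaleN1r addNr mulN1r addNr.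
Qed.

Let goodD G u x v y : good G -> G (u, x) -> G (v, y) -> G (u + v, x + y).
Proof. by move=> [lG _] Gu /(lG 1 _ _ _ _ Gu); rewrite toC1 scale1r mul1r. Qed.

Let goodZ G a u x : good G -> G (u, x) -> G (toC a *: u, a * x).
Proof.
move=> gG Gu; have G0 : G (0, 0) by apply: good0 => //; exists (u, x).
by have := gG.1 a _ _ _ _ Gu G0; rewrite !addr0.
Qed.

(** The value at v0 must lie above every x - c |u - v0| and below every c |u + v0| - x with (u, x)
    in G. By the triangle inequality the former never exceed the latter, and [al] is the supremum of
    the former. The bound at u + t v0 follows by dividing by |t|; the sign of t decides which
    inequality is used. *)
Let extend G (v0 : V) : 0 <= c -> good G -> G !=set0 ->
  exists B, [/\ good B, G `<=` B & exists a, B (v0, a)].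
Proof.
move=> c0 gG Gn0; have G0 := good0 gG Gn0.
have [lG bG] := gG.
pose S := [set s : R | exists u x, G (u, x) /\ s = x - c * rnorm (u - v0)].
have S_ub u x : G (u, x) -> ubound S (c * rnorm (u + v0) - x).
  move=> Gu _ [v [y [Gv ->]]]; rewrite lerBlDr addrAC lerBrDr addrC.
  rewrite addrC; apply: le_trans (bG _ _ (goodD gG Gv Gu)) _.
  rewrite [X in _ <= X](_ : _ = c * (rnorm (u + v0) + rnorm (v - v0))).
    apply: ler_wpM2l => //; apply: le_trans (rnormD _ _).
    by rewrite addrACA subrr addr0 addrC.
  by rewrite mulrDr.
have S_sup : has_sup S.
  split; first by exists (0 - c * rnorm (0 - v0)), 0, 0.
  by exists (c * rnorm (0 + v0) - 0); exact: S_ub.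
pose al := sup S.
have al_lo u x : G (u, x) -> x - c * rnorm (u - v0) <= al.
  by move=> Gu; apply: ub_le_sup; [exact: S_sup.2|exists u, x].
have al_hi u x : G (u, x) -> al <= c * rnorm (u + v0) - x.
  by move=> Gu; apply: ge_sup; [exact: S_sup.1|exact: S_ub].
pose B := [set q : V * R | exists u x t,
  [/\ G (u, x), q.1 = u + toC t *: v0 & q.2 = x + t * al]].
exists B; split; last first.
- by exists al, 0, 0, 1; rewrite toC1 scale1r mul1r !add0r.
- by move=> [u x] Gu; exists u, x, 0; rewrite toC0 scale0r mul0r !addr0.
split=> [a _ _ _ _ [u [x [t [Gu /= -> ->]]]] [v [y [s [Gv /= -> ->]]]]|].
  exists (toC a *: u + v), (a * x + y), (a * t + s); split; first exact: lG.
    by rewrite /= toCD toCM scalerDr scalerDl scalerA addrACA.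
  by rewrite /=; ring.
move=> _ _ [u [x [t [Gu /= -> ->]]]].
have [t0|t0|->] := ltrgt0P t; last first.
- by rewrite toC0 scale0r mul0r !addr0; exact: bG.
- have tn : 0 < - t by rewrite oppr_gt0.
  have := al_lo _ _ (goodZ (- t)^-1 gG Gu).
  have -> : u + toC t *: v0 = toC (- t) *: (toC (- t)^-1 *: u - v0).
    rewrite scalerBr scalerA -toCM mulfV ?gt_eqF // toC1 scale1r.
    by rewrite toCN scaleNr opprK.
  rewrite rnorm_scale rnorm_toC gtr0_norm // => h.
  rewrite mulrCA -ler_pdivrMl // mulrDr.
  have -> : (- t)^-1 * (t * al) = - al by field; rewrite lt_eqF.
  lra.
have := al_hi _ _ (goodZ t^-1 gG Gu).
have -> : u + toC t *: v0 = toC t *: (toC t^-1 *: u + v0).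
  by rewrite scalerDr scalerA -toCM mulfV ?gt_eqF // toC1 scale1r.
rewrite rnorm_scale rnorm_toC gtr0_norm // => h.
rewrite mulrCA -ler_pdivrMl // mulrDr mulKf ?gt_eqF //.
lra.
Qed.

Lemma real_hahn_banach (G : set (V * R)) : 0 <= c -> G (0, 0) ->
  (forall a u x v y, G (u, x) -> G (v, y) -> G (toC a *: u + v, a * x + y)) ->
  (forall u x, G (u, x) -> x <= c * rnorm u) ->
  exists f : V -> R, [/\ forall a u v, f (toC a *: u + v) = a * f u + f v,
    forall u, f u <= c * rnorm u & forall u x, G (u, x) -> f u = x].
Proof.
move=> c0 G0 lG bG.
(* Adjoining G makes the union of the empty chain admissible in Zorn's lemma. *)
pose P (A : set (V * R)) := good (A `|` G).
have [F FP Ftot|A [PA Amax]] := @Zorn_bigcup _ P.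
  have pick q1 q2 : ((\bigcup_(X in F) X) `|` G) q1 ->
      ((\bigcup_(X in F) X) `|` G) q2 ->
      exists A, [/\ good A, A q1, A q2 & A `<=` (\bigcup_(X in F) X) `|` G].
    have sub A : F A -> A `|` G `<=` (\bigcup_(X in F) X) `|` G.
      by move=> FA q [Aq|]; [left; exists A|right].
    move=> [[A FA Aq1]|Gq1] [[B FB Bq2]|Gq2].
    - have [AB|BA] := Ftot _ _ FA FB.
        exists (B `|` G); split; [exact: FP|left; exact: AB|by left|exact: sub].
      exists (A `|` G); split; [exact: FP|by left|left; exact: BA|exact: sub].
    - by exists (A `|` G); split; [exact: FP|left|right|exact: sub].
    - by exists (B `|` G); split; [exact: FP|right|left|exact: sub].
    - by exists G; split => //; exact: subsetUr.
  split=> [a u x v y h1 h2|u x h].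
    by have [A [gA A1 A2]] := pick _ _ h1 h2; apply; exact: gA.1.
  by have [A [gA A1 _ _]] := pick _ _ h h; exact: gA.2.
pose D := A `|` G.
have D0 : D (0, 0) by right.
have gD : good D := PA.
have D_total u : exists x, D (u, x).
  have [B [gB DB [a Ba]]] := extend u c0 gD (ex_intro _ _ D0).
  exists a; left; apply: contrapT => nAa.
  have AB : A `<` B.
    split; first by move=> q Aq; apply: DB; left.
    by move=> BA; apply/nAa/BA.
  apply: Amax AB _; rewrite /P.
  suff -> : B `|` G = B by [].
  by apply/seteqP; split=> q; [case=> // Gq; apply: DB; right|left].
have [f fP] := choice D_total.
(* The bound alone forces a graph to be single-valued: (0, x - y) lies in D, hence x - y <= 0, and
   symmetrically. *)
have D_fun u x y : D (u, x) -> D (u, y) -> x = y.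
  have half x' y' : D (u, x') -> D (u, y') -> x' <= y'.
    move=> Dx Dy; have := goodD gD Dx (goodZ (-1) gD Dy).
    move=> /(gD.2); rewrite toCN toC1 scaleN1r subrr rnorm0 mulr0 mulN1r.
    by rewrite subr_le0.
  by move=> Dx Dy; apply/eqP; rewrite eq_le !half.
exists f; split=> [a u v|u|u x Gu].
- by apply: D_fun (fP _) _; exact: gD.1.
- exact: gD.2 (fP u).
- by apply: D_fun (fP _) _; right.
Qed.

End RealHahnBanach.

Section HahnBanach.
Context {R : realType}.
Notation C := (Cplx R).
Variables (V : normedModType C) (c : R) (G : set (V * C)).
Hypotheses (c0 : 0 <= c) (G0 : G (0, 0)).
Hypothesis G_lin : forall (a : C) u x v y,
  G (u, x) -> G (v, y) -> G (a *: u + v, a * x + y).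
Hypothesis G_le : forall u x, G (u, x) -> rnorm x <= c * rnorm u.

Let imag : C := 'i.

Let imagK : imag * imag = -1.
Proof. by rewrite /imag -expr2 sqr_i. Qed.

Let ReM_toC a (z : C) : complex.Re (toC a * z) = a * complex.Re z.
Proof. by case: z => x y; rewrite /toC /=; simpc. Qed.

Let ReD (z w : C) : complex.Re (z + w) = complex.Re z + complex.Re w.
Proof. by case: z => x y; case: w. Qed.

Let Re_le (z : C) : complex.Re z <= rnorm z.
Proof.
apply: le_trans (ler_norm _) _; rewrite -leCR -normC_rnorm.
exact: normc_ge_Re.
Qed.

Let decomp (z : C) :
  z = toC (complex.Re z) - imag * toC (complex.Re (imag * z)).
Proof. by case: z => x y; rewrite /toC /imag; simpc; rewrite ?opprK ?mulr0. Qed.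

Let Re_toC a : complex.Re (toC a : C) = a.
Proof. by []. Qed.

Let Re_imag a : complex.Re (imag * toC a : C) = 0.
Proof. by rewrite /toC /imag; simpc. Qed.

(* A real functional f extending Re on the graph gives the complex functional
   u |-> f u - i f (i u), whose real part is f. *)
Lemma hahn_banach : exists psi : dual V,
  (forall u x, G (u, x) -> psi u = x) /\ rnorm psi <= c.
Proof.
pose GR := [set q : V * R | exists2 x, G (q.1, x) & q.2 = complex.Re x].
have [|||f [f_lin f_le fG]] := @real_hahn_banach _ V c GR c0.
- by exists 0.
- move=> a u x' v y' [x Gu /= ->] [y Gv /= ->].
  by exists (toC a * x + y); [exact: G_lin|rewrite /= ReD ReM_toC].
- move=> u x' [x Gu /= ->]; apply: le_trans (Re_le _) _; exact: G_le.
have fD u v : f (u + v) = f u + f v.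
  by rewrite -[u]scale1r -toC1 f_lin mul1r toC1 scale1r.
have f0 : f 0 = 0 by have := fD 0 0; rewrite addr0; lra.
have fZ a u : f (toC a *: u) = a * f u.
  by rewrite -[_ *: _]addr0 f_lin f0 addr0.
have fN u : f (- u) = - f u.
  by have := fZ (-1) u; rewrite toCN toC1 scaleN1r mulN1r.
pose g (u : V) : C := toC (f u) - imag * toC (f (imag *: u)).
have gD u v : g (u + v) = g u + g v.
  by rewrite /g scalerDr !fD !toCD mulrDr opprD addrACA.
have gR a u : g (toC a *: u) = toC a * g u.
  have ia : imag *: (toC a *: u) = toC a *: (imag *: u).
    by rewrite !scalerA [imag * _]mulrC.
  rewrite /g ia !fZ !toCM.
  by rewrite mulrBr [imag * (_ * _)]mulrCA.
have gI u : g (imag *: u) = imag * g u.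
  rewrite /g scalerA imagK scaleN1r fN mulrBr mulrA imagK toCN mulrN opprK.
  by rewrite mulN1r opprK addrC.
have gN u : g (- u) = - g u.
  by have := gR (-1) u; rewrite toCN toC1 scaleN1r mulN1r.
have g_lin : linear g.
  move=> a u v; rewrite gD; congr (_ + _).
  rewrite [in LHS](decomp a) scalerBl gD gN -scalerA gI !gR.
  by rewrite [in RHS](decomp a) [RHS]mulrBl [imag * _]mulrA.
have Re_g u : complex.Re (g u) = f u.
  rewrite /g -mulN1r -toC1 -toCN ReD ReM_toC Re_imag mulr0 addr0.
  exact: Re_toC.
have g_le u : rnorm (g u) <= c * rnorm u.
  have [g0|gn0] := eqVneq (g u) 0.
    by rewrite g0 rnorm0 mulr_ge0 ?rnorm_ge0.
  have gp : 0 < rnorm (g u) by rewrite rnorm_gt0.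
  (* The phase [th] rotates [g u] to a nonnegative real number, which is then a value of f and obeys
     its bound. *)
  pose th : C := toC (rnorm (g u)) / g u.
  have th1 : rnorm th = 1.
    have : rnorm th * rnorm (g u) = rnorm (g u).
      by rewrite -rnormM /th divfK // rnorm_toC gtr0_norm.
    by move/(canRL (mulfK (lt0r_neq0 gp))) ->; rewrite divff ?gt_eqF.
  have gth : g (th *: u) = toC (rnorm (g u)).
    have := g_lin th u 0; rewrite !addr0 => ->.
    have g0 : g 0 = 0 by have := gR 0 0; rewrite toC0 scale0r mul0r.
    by rewrite g0 addr0; exact: divfK.
  have := f_le (th *: u); rewrite -Re_g gth rnorm_scale th1 mul1r.
  by rewrite Re_toC.
exists (BoundedOp (bounded_opP g_lin g_le) : dual V); split; last first.
  by apply: (op_norm_bound c0); exact: g_le.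
move=> u x Gu; rewrite /= /g [RHS]decomp.
congr (toC _ - _ * toC _); apply: fG; first by exists x.
exists (imag * x) => //=.
by have := G_lin imag Gu G0; rewrite !addr0.
Qed.

End HahnBanach.

(** * Power series *)

Section PowerSeries.
Context {R : realType}.
Notation C := (Cplx R).
Implicit Types V W : normedModType C.

Lemma series_shift V (u : nat -> V) (n m : nat) :
  series (fun j => u (n + j)%N) m = series u (n + m)%N - series u n.
Proof.
rewrite !seriesES; elim: m => [|m IH]; first by rewrite addn0 big_ord0 subrr.
by rewrite addnS !big_ord_recr /= IH addrAC.
Qed.

Lemma cvg_series_terms_bounded V (u : nat -> V) (l : V) :
  series u @ \oo --> l -> exists2 B, 0 <= B & forall n, rnorm (u n) <= B.
Proof.
move=> /cvg_rnorm/(_ 1 ltr01)[n0 h].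
have s0 n : 0 <= \sum_(k < n) rnorm (u k).
  by apply: sumr_ge0 => k _; exact: rnorm_ge0.
exists (\sum_(k < n0) rnorm (u k) + 2) => [|n]; first exact: addr_ge0.
have [lt|ge] := ltnP n n0.
  rewrite (bigD1 (Ordinal lt)) //= -addrA lerDl addr_ge0 //.
  by apply: sumr_ge0 => k _; exact: rnorm_ge0.
apply: ler_wpDl => //.
have -> : u n = (series u n.+1 - l) - (series u n - l).
  by rewrite opprB addrA subrK !seriesES big_ord_recr /= addrAC subrr add0r.
apply: le_trans (rnormB _ _) _; rewrite -[2]/(1 + 1).
by apply: lerD; apply/ltW/h => //; exact: leq_trans ge (leqnSn _).
Qed.

(** Convergence at the single point z0 + s / 2 bounds all terms there by B. Shrinking the radius to
    s / 4 gains a factor 2^-k in the k-th term, which makes the remainder of every order summable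
    with total 2B. *)
Lemma ps_bound V (a : nat -> V) (z0 : C) (f : C -> V) :
  (\forall z \near z0, series (fun n => (z - z0) ^+ n *: a n) @ \oo --> f z) ->
  exists r K, [/\ 0 < r, 0 <= K & forall z, rnorm (z - z0) < r ->
    series (fun n => (z - z0) ^+ n *: a n) @ \oo --> f z /\
    forall n, rnorm (f z - \sum_(k < n) (z - z0) ^+ k *: a k) <=
      K * (rnorm (z - z0) / r) ^+ n].
Proof.
move=> /nbhs_rnorm[s s0 fs].
have s2 : 0 < s / 2 by rewrite divr_gt0.
have [|B B0 aB] := cvg_series_terms_bounded (fs (z0 + toC (s / 2)) _).
  by rewrite addrC addKr rnorm_toC gtr0_norm // ltr_pdivrMr // ltr_pMr ?ltr1n.
exists (s / 4), (2 * B); split; rewrite ?divr_gt0 ?mulr_ge0 // => z zr.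
have zs : series (fun n => (z - z0) ^+ n *: a n) @ \oo --> f z.
  by apply: fs; apply: lt_trans zr _; rewrite ltr_pdivrMr // ltr_pMr ?ltr1n.
split=> // n.
set w := z - z0 in zr zs *; set q := rnorm w / (s / 4).
have q0 : 0 <= q by rewrite divr_ge0 ?rnorm_ge0 // ltW // divr_gt0.
have q1 : q <= 1 by rewrite ler_pdivrMr ?divr_gt0 // mul1r ltW.
have term k : rnorm (w ^+ k *: a k) <= B * (q / 2) ^+ k.
  have := aB k; rewrite addrC addKr !rnorm_scale !rnormX rnorm_toC gtr0_norm // => h.
  have -> : rnorm w = (s / 2) * (q / 2) by rewrite /q; field; rewrite gt_eqF.
  rewrite exprMn mulrAC mulrC [B * _]mulrC.
  by rewrite ler_wpM2l // exprn_ge0 // divr_ge0.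
rewrite -mulrA; apply: (@fast_lim_le _ _ (fun j => w ^+ (n + j) *: a (n + j)%N)).
  move=> j; apply: le_trans (term _) _; rewrite -[leRHS]mulrA ler_wpM2l //.
  have -> : (q / 2) ^+ (n + j) = (q ^+ n / 2 ^+ j) * (q ^+ j * (2 ^+ n)^-1).
    by rewrite expr_div_n !exprD invfM; ring.
  rewrite ler_piMr ?divr_ge0 ?exprn_ge0 //.
  rewrite mulr_ile1 ?invr_ge0 ?exprn_ge0 ?exprn_ile1 //.
  by rewrite invf_le1 ?exprn_gt0 // exprn_ege1 // ler1n.
pose u k := w ^+ k *: a k.
rewrite (_ : \sum_(k < n) _ = series u n); last by rewrite seriesES.
rewrite (_ : series (fun j => w ^+ (n + j) *: a (n + j)%N) =
  fun m => series u (m + n)%N - series u n);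
  last first.
  by apply/funext => m; rewrite (series_shift u) addnC.
by apply: cvg_add (cvg_const _); exact: cvg_rnorm_shift.
Qed.

Lemma analytic_continuous V (f : C -> V) (z0 : C) : analytic_at f z0 ->
  forall e, 0 < e ->
  exists2 d, 0 < d & forall z, rnorm (z - z0) < d -> rnorm (f z - f z0) < e.
Proof.
move=> [a /ps_bound[r [K [r0 K0 h]]]] e e0.
have f0 : f z0 = a 0%N.
  have [|_ /(_ 1%N)] := h z0; first by rewrite subrr rnorm0.
  rewrite subrr rnorm0 mul0r expr1 mulr0 big_ord1 expr0 scale1r => le0.
  apply/eqP; rewrite -subr_eq0; apply/eqP/rnorm0_eq0/eqP.
  by rewrite eq_le le0 rnorm_ge0.
have K1 : 0 < K + 1 by rewrite ltr_wpDl.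
exists (Num.min r (r * (e / (K + 1)))).
  by rewrite lt_min r0 mulr_gt0 ?divr_gt0.
move=> z; rewrite lt_min => /andP[zr ze].
have [_ /(_ 1%N)] := h z zr; rewrite big_ord1 expr0 scale1r expr1 f0.
move=> /le_lt_trans; apply.
apply: (@le_lt_trans _ _ (K * (e / (K + 1)))).
  by rewrite ler_wpM2l // ler_pdivrMr // mulrC ltW.
by rewrite mulrCA gtr_pMr // ltr_pdivrMr // mul1r ltrDl.
Qed.

Definition zeros_cluster V (f : C -> V) (z0 : C) : Prop :=
  forall d, 0 < d -> exists z, [/\ z != z0, rnorm (z - z0) < d & f z = 0].

(** If the coefficients before the n-th vanish, the remainder of order n + 1 at a zero z bounds |a
    n| by a constant times |z - z0|, and z can be taken arbitrarily close to z0. *)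
Lemma ps_coeffs_eq0 V (a : nat -> V) (z0 : C) (f : C -> V) :
  (\forall z \near z0, series (fun n => (z - z0) ^+ n *: a n) @ \oo --> f z) ->
  zeros_cluster f z0 -> forall n, a n = 0.
Proof.
move=> /ps_bound[r [K [r0 K0 h]]] fz; apply: ltn_ind => n IH.
apply: rnorm0_eq0; apply/eqP; rewrite eq_le rnorm_ge0 andbT.
apply: le_eps0 => e e0.
have K1 : 0 < K / r ^+ n.+1 + 1.
  by rewrite ltr_wpDl // divr_ge0 // exprn_ge0 // ltW.
have d0 : 0 < Num.min r (e / (K / r ^+ n.+1 + 1)) by rewrite lt_min r0 divr_gt0.
have [z [zz0]] := fz _ d0; rewrite lt_min => /andP[zr ze] fz0.
have w0 : 0 < rnorm (z - z0) by rewrite rnorm_gt0 subr_eq0.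
have [_ /(_ n.+1)] := h z zr.
rewrite fz0 sub0r rnormN big_ord_recr /= big1 => [|k _]; last first.
  by rewrite (IH k (ltn_ord k)) scaler0.
rewrite add0r rnorm_scale rnormX expr_div_n [in leRHS]exprSr => le.
have {}le : rnorm (a n) <= K / r ^+ n.+1 * rnorm (z - z0).
  rewrite -(ler_pM2l (exprn_gt0 n w0)); apply: le_trans le _.
  by rewrite le_eqVlt; apply/orP; left; apply/eqP; ring.
apply: le_trans le _; rewrite ltr_pdivlMr // in ze.
apply: le_trans (ltW ze); rewrite mulrC ler_wpM2l ?rnorm_ge0 //.
by rewrite lerDl.
Qed.

Lemma identity_principle V (f : C -> V) (z0 : C) :
  analytic_at f z0 -> zeros_cluster f z0 ->
  exists2 d, 0 < d & forall z, rnorm (z - z0) < d -> f z = 0.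
Proof.
move=> [a fa] /(ps_coeffs_eq0 fa) a0; have /nbhs_rnorm[r r0 h] := fa.
exists r => // z /h fz; apply: cvg_uniq fz _.
rewrite (_ : series _ = fun=> 0); first exact: cvg_const.
apply/funext => n; rewrite seriesES big1 // => k _.
by rewrite a0 scaler0.
Qed.

(** The local identity principle is carried along the segment from 0 to z. At the supremum t of the
    parameters up to which f vanishes, zeros cluster from the left, so f vanishes on a disc around t
    z and t cannot be smaller than 1. *)
Lemma analytic_eq0_ball V (f : C -> V) (r : R) :
  (forall z, rnorm z < r -> analytic_at f z) ->
  (exists2 d, 0 < d & forall z, rnorm z < d -> f z = 0) ->
  forall z, rnorm z < r -> f z = 0.
Proof.
move=> fa [d d0 fd] z zr.
have [->|z0] := eqVneq z 0; first by apply: fd; rewrite rnorm0.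
have zp : 0 < rnorm z by rewrite rnorm_gt0.
pose E := [set t : R | t <= 1 /\ forall s, 0 <= s <= t -> f (toC s * z) = 0].
have E_sup : has_sup E.
  split; last by exists 1 => t [].
  exists 0; split=> // s s0; have -> : s = 0 by apply/le_anti; rewrite andbC.
  by rewrite toC0 mul0r; apply: fd; rewrite rnorm0.
pose t := sup E.
have Et s : 0 <= s < t -> f (toC s * z) = 0.
  move=> /andP[s0 st]; have st0 : 0 < t - s by rewrite subr_gt0.
  have [x [_ h]] := sup_adherent st0 E_sup.
  by rewrite -/t subKr => /ltW sx; apply: h; rewrite s0.
have t1 : t <= 1 by apply: ge_sup; [exact: E_sup.1|move=> x []].
have zdist (s s' : R) : rnorm (toC s * z - toC s' * z) = `|s - s'| * rnorm z.
  by rewrite -mulrBl rnormM -toCN -toCD rnorm_toC.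
have t0 : 0 < t.
  pose x := Num.min 1 (d / (2 * rnorm z)).
  have x0 : 0 < x by rewrite lt_min ltr01 divr_gt0 // mulr_gt0.
  apply: lt_le_trans x0 _; apply: ub_le_sup; first exact: E_sup.2.
  split=> [|s /andP[s0]]; first by rewrite ge_min lexx.
  rewrite le_min => /andP[_ sx]; apply: fd.
  rewrite rnormM rnorm_toC ger0_norm //.
  apply: le_lt_trans (ler_wpM2r (ltW zp) sx) _.
  have -> : d / (2 * rnorm z) * rnorm z = d / 2 by field; rewrite gt_eqF.
  by rewrite ltr_pdivrMr // ltr_pMr // ltr1n.
have tr : rnorm (toC t * z) < r.
  rewrite rnormM rnorm_toC gtr0_norm //; apply: le_lt_trans zr.
  by rewrite ler_piMl // ltW.
have acc : zeros_cluster f (toC t * z).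
  move=> e e0; pose s := Num.max 0 (t - e / (2 * rnorm z)).
  have st : s < t by rewrite gt_max t0 gtrBl divr_gt0 // mulr_gt0.
  have s0 : 0 <= s by rewrite le_max lexx.
  exists (toC s * z); split; last by apply: Et; rewrite s0.
    by rewrite -subr_eq0 -rnorm_gt0 zdist mulr_gt0 // normr_gt0 subr_eq0 lt_eqF.
  rewrite zdist distrC gtr0_norm ?subr_gt0 //.
  apply: le_lt_trans (_ : e / (2 * rnorm z) * rnorm z < e).
    by rewrite ler_pM2r // lerBlDr -lerBlDl le_max lexx orbT.
  have -> : e / (2 * rnorm z) * rnorm z = e / 2 by field; rewrite gt_eqF.
  by rewrite ltr_pdivrMr // ltr_pMr // ltr1n.
have [e e0 fe] := identity_principle (fa _ tr) acc.
have fez s : `|s - t| < e / rnorm z -> f (toC s * z) = 0.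
  by move=> lt; apply: fe; rewrite zdist -ltr_pdivlMr.
suff t_1 : t = 1.
  rewrite -[z]mul1r -toC1; apply: fez.
  by rewrite t_1 subrr normr0 divr_gt0.
apply/eqP; rewrite eq_le t1 leNgt; apply/negP => lt1.
pose x := Num.min 1 (t + e / (2 * rnorm z)).
have tx : t < x by rewrite lt_min lt1 ltrDl divr_gt0 // mulr_gt0.
suff : x <= t by rewrite leNgt tx.
apply: ub_le_sup; first exact: E_sup.2.
split=> [|s /andP[s0]]; first by rewrite ge_min lexx.
rewrite le_min => /andP[_ sx]; have [lt|ge] := ltP s t.
  by apply: Et; rewrite s0.
apply: fez; rewrite ger0_norm ?subr_ge0 //.
rewrite ltrBlDl; apply: le_lt_trans sx _; rewrite ltrD2l.
by rewrite ltr_pM2l // ltf_pV2 ?posrE ?mulr_gt0 // ltr_pMl // ltr1n.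
Qed.

(** Terms with k > n are 0, so the range of k may exceed n; binomial sums for different n can then
    be compared with sums over k < m for an unrelated m. *)
Lemma binomial_sum (K : comNzRingType) (x y : K) n N : (n < N)%N ->
  \sum_(k < N) (x ^+ (n - k) * y ^+ k) *+ 'C(n, k) = (x + y) ^+ n.
Proof.
move=> nN; rewrite exprDn.
rewrite -(big_mkord xpredT (fun k => (x ^+ (n - k) * y ^+ k) *+ 'C(n, k))).
rewrite (big_cat_nat _ nN) //= big_mkord [X in _ + X]big1_seq ?addr0 // => k.
by rewrite mem_index_iota => /andP[_ /andP[nk _]]; rewrite bin_small ?mulr0n.
Qed.

End PowerSeries.

(** * Generating functions of geometrically bounded chains *)

Section Chains.
Context {R : realType}.
Notation C := (Cplx R).
Variables (V : normedModType C) (a : nat -> V) (c d : R).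
Hypotheses (bV : banach V) (d0 : 0 < d).
Hypothesis a_le : forall n, rnorm (a n) <= c * d ^+ n.

Let c0 : 0 <= c.
Proof.
by have := a_le 0; rewrite expr0 mulr1; apply: le_trans; exact: rnorm_ge0.
Qed.

Let term_le (q : R) (z : C) n : 0 <= q -> rnorm z <= q ^+ n -> q * d <= 2^-1 ->
  rnorm (z *: a n) <= c / 2 ^+ n.
Proof.
move=> q0 zq qd; rewrite rnorm_scale.
apply: le_trans (ler_pM (rnorm_ge0 _) (rnorm_ge0 _) zq (a_le n)) _.
rewrite mulrCA -exprMn ler_wpM2l // -exprVn.
by rewrite lerXn2r ?nnegrE ?mulr_ge0 ?invr_ge0 // ltW.
Qed.

Lemma power_series_sum : exists F : C -> V, forall z : C, rnorm z * d <= 2^-1 ->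
  series (fun n => z ^+ n *: a n) @ \oo --> F z.
Proof.
suff /choice[F h] : forall z : C, exists s : V, rnorm z * d <= 2^-1 ->
    series (fun n => z ^+ n *: a n) @ \oo --> s by exists F.
move=> z; have [zd|zd] := boolP (rnorm z * d <= 2^-1); last by exists 0.
have [|s sP] := bV (u := fun n => z ^+ n *: a n) (c := c).
  by move=> n; apply: term_le zd; rewrite ?rnorm_ge0 // rnormX.
by exists s.
Qed.

(* Re-expansion about l: the k-th coefficient is
   psi k = \sum_n 'C(n, k) l ^ (n - k) a n, and since |z - l| <= t / 2 the
   remainder of order m is at most 2 ^ -m \sum_n (|l| + t) ^ n |a n|. *)
Lemma power_series_analytic (F : C -> V) :
  (forall z : C, rnorm z * d <= 2^-1 ->
     series (fun n => z ^+ n *: a n) @ \oo --> F z) ->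
  forall l : C, rnorm l * d < 4^-1 -> analytic_at F l.
Proof.
(* Since |l| d < 1/4 and t d = 1/4, the number q = |l| + t still satisfies q d <= 1/2, as [term_le]
   asks. *)
move=> FP l ld; pose t := (4 * d)^-1.
have t0 : 0 < t by rewrite invr_gt0 mulr_gt0.
have td : t * d = 4^-1 by rewrite /t; field; rewrite gt_eqF.
pose q := rnorm l + t.
have q0 : 0 <= q by rewrite addr_ge0 ?rnorm_ge0 // ltW.
have qd : q * d <= 2^-1 by rewrite /q mulrDl td; move/ltW: ld; lra.
pose b n k x := (l ^+ (n - k) * x ^+ k) *+ 'C(n, k).
pose e k n : C := l ^+ (n - k) *+ 'C(n, k).
have rb n k x : rnorm (b n k x) = (rnorm l ^+ (n - k) * rnorm x ^+ k) *+ 'C(n, k).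
  by rewrite /b rnormMn rnormM !rnormX.
have b_le n N : \sum_(k < N) (rnorm l ^+ (n - k) * t ^+ k) *+ 'C(n, k) <= q ^+ n.
  rewrite -(@binomial_sum _ (rnorm l) t n (maxn n.+1 N)) ?leq_maxl //.
  rewrite (big_ord_widen (maxn n.+1 N)
    (fun k => (rnorm l ^+ (n - k) * t ^+ k) *+ 'C(n, k))) ?leq_maxr //.
  rewrite [leRHS](bigID (fun k : 'I__ => (k < N)%N)) /= lerDl.
  apply: sumr_ge0 => k _; rewrite mulrn_wge0 // mulr_ge0 // exprn_ge0 //;
      rewrite ?rnorm_ge0 //.
  exact: ltW.
have e_le k n : rnorm (toC (t ^+ k) * e k n) <= q ^+ n.
  apply: le_trans (b_le n k.+1); rewrite big_ord_recr /=.
  rewrite -[leLHS]add0r; apply: lerD.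
    apply: sumr_ge0 => j _; rewrite mulrn_wge0 // mulr_ge0 // exprn_ge0 //;
      rewrite ?rnorm_ge0 //.
    exact: ltW.
  rewrite rnormM rnorm_toC ger0_norm ?(exprn_ge0 _ (ltW t0)) //.
  by rewrite /e rnormMn rnormX mulrnAr mulrC.
have psi_ex k : exists s : V, series (fun n => e k n *: a n) @ \oo --> s.
  (* After multiplication by t^k the coefficient is, in norm, one term of the binomial expansion of
     q^n; the factor is then divided out of the sum. *)
  have [|s sP] := bV (u := fun n => (toC (t ^+ k) * e k n) *: a n) (c := c).
    by move=> n; apply: term_le qd.
  exists (toC (t ^+ k)^-1 *: s).
  have := cvg_scale (toC (t ^+ k)^-1) sP.
  rewrite (_ : (fun n => _) = series (fun n => e k n *: a n)) //.
  apply/funext => n; rewrite !seriesES scaler_sumr; apply: eq_bigr => j _.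
  by rewrite !scalerA mulrA -toCM mulVf ?expf_neq0 ?gt_eqF // toC1 mul1r.
have [psi psiP] := choice psi_ex.
exists psi; apply/nbhs_rnorm; exists (t / 2); first by rewrite divr_gt0.
move=> z zl; set w := z - l in zl *.
have zd : rnorm z * d <= 2^-1.
  apply: le_trans qd; rewrite ler_pM2r // /q -[z](subrK l) -/w addrC.
  apply: le_trans (rnormD _ _) _; rewrite lerD2l.
  by apply: le_trans (ltW zl) _; rewrite ler_pdivrMr // ler_pMr // ler1n.
have le_psi m : rnorm (F z - series (fun k => w ^+ k *: psi k) m) <= 2 * c / 2 ^+ m.
  pose g n := z ^+ n - \sum_(k < m) w ^+ k * e k n.
  have g_le n : rnorm (g n) <= (2 ^+ m)^-1 * q ^+ n.
    have gE : g n = \sum_(k < maxn n.+1 m | ~~ (k < m)%N) b n k w.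
      rewrite /g -[z](subrK l) -/w [w + l]addrC.
      rewrite -(@binomial_sum _ l w n (maxn n.+1 m)) ?leq_maxl //.
      rewrite (bigID (fun k : 'I__ => (k < m)%N)) /=.
      rewrite -(big_ord_widen _ (fun k => b n k w)) ?leq_maxr //.
      rewrite addrAC (_ : \sum_(k < m) _ = \sum_(k < m) w ^+ k * e k n) ?subrr ?add0r //.
      by apply: eq_bigr => k _; rewrite /b /e mulrnAr mulrC.
    rewrite gE; apply: le_trans (_ : _ <= \sum_(k < maxn n.+1 m | ~~ (k < m)%N)
        (2 ^+ m)^-1 * ((rnorm l ^+ (n - k) * t ^+ k) *+ 'C(n, k))) _.
      elim/big_ind2: _ => [|x1 x2 y1 y2 h1 h2|k]; first by rewrite rnorm0.
        exact: le_trans (rnormD _ _) (lerD h1 h2).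
      rewrite -leqNgt => mk; rewrite rb -mulrnAr; rewrite -mulrnAr mulrCA.
      rewrite ler_wpM2l ?exprn_ge0 ?rnorm_ge0 // mulrnAr lerMn2r; apply/orP; right.
      apply: le_trans (_ : (t / 2) ^+ k <= _).
        by rewrite lerXn2r ?nnegrE ?rnorm_ge0 ?divr_ge0 // ltW.
      rewrite expr_div_n mulrC ler_wpM2r ?(exprn_ge0 _ (ltW t0)) //.
      by rewrite lef_pV2 ?posrE ?exprn_gt0 // ler_eXn2l // ltr1n.
    rewrite -mulr_sumr ler_wpM2l ?invr_ge0 ?exprn_ge0 //.
    apply: le_trans (b_le n (maxn n.+1 m)).
    rewrite [leRHS](bigID (fun k : 'I__ => (k < m)%N)) /= lerDr.
    apply: sumr_ge0 => k _; rewrite mulrn_wge0 // mulr_ge0 // exprn_ge0 //;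
      rewrite ?rnorm_ge0 //.
    exact: ltW.
  rewrite -mulrA; apply: (@fast_lim_le _ _ (fun n => g n *: a n)) => [n|].
    have -> : c / 2 ^+ m / 2 ^+ n = (2 ^+ m)^-1 * (c / 2 ^+ n) by rewrite mulrAC mulrC.
    have -> : g n *: a n = toC (2 ^+ m)^-1 *: ((toC (2 ^+ m) * g n) *: a n).
      rewrite scalerA mulrA -toCM mulVf ?expf_neq0 ?pnatr_eq0 //.
      by rewrite toC1 mul1r.
    rewrite rnorm_scale rnorm_toC ger0_norm ?invr_ge0 ?exprn_ge0 //.
    rewrite ler_pM2l ?invr_gt0 ?exprn_gt0 //; apply: term_le qd => //.
    rewrite rnormM rnorm_toC ger0_norm ?exprn_ge0 //.
    by rewrite -ler_pdivlMl ?exprn_gt0.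
  have h := @cvg_add _ _ _
    (fun N => - \sum_(k < m) w ^+ k *: series (fun n => e k n *: a n) N) _ (- \sum_(k < m) w ^+ k *: psi k) (FP _ zd).
  rewrite seriesES (_ : series _ = fun N => series (fun n => z ^+ n *: a n) N
     - \sum_(k < m) w ^+ k *: series (fun n => e k n *: a n) N).
    apply: h; elim: m {g g_le} => [|m IH].
      rewrite big_ord0 oppr0; under eq_fun do rewrite big_ord0 oppr0.
      exact: cvg_const.
    under eq_fun do rewrite big_ord_recr opprD /=; rewrite big_ord_recr opprD /=.
    apply: cvg_add IH _; rewrite -scaleNr; under eq_fun do rewrite -scaleNr.
    exact: cvg_scale.
  apply/funext => N; rewrite !seriesES.
  rewrite [X in _ - X](eq_bigr
    (fun k : 'I_m => \sum_(n < N) w ^+ k *: (e k n *: a n))); last first.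
    by move=> k _; rewrite seriesES scaler_sumr.
  rewrite exchange_big /= -sumrB; apply: eq_bigr => n _.
  rewrite /g scalerBl scaler_suml; congr (_ - _); apply: eq_bigr => k _.
  by rewrite scalerA.
apply/cvg_rnorm => eps eps0; have [n0 lt] := exp2_lt (2 * c) eps0.
exists n0 => n n0n; rewrite rnormC; apply: le_lt_trans (le_psi n) _.
apply: le_lt_trans lt; apply: ler_wpM2l; first by rewrite mulr_ge0.
by rewrite lef_pV2 ?posrE ?exprn_gt0 // ler_eXn2l // ltr1n.
Qed.

(** S lowers the index by one, so on the generating function it acts as multiplication by z up to
    the term [S (a 0)]. If that term is y, then F z solves (S - z) x = y; if it is 0, then F z is an
    eigenvector when nonzero. *)
Lemma chain_sum (S : bounded_op V V) (F : C -> V) z :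
  (forall n, S (a n.+1) = a n) ->
  series (fun n => z ^+ n *: a n) @ \oo --> F z -> S (F z) = S (a 0%N) + z *: F z.
Proof.
move=> Sa Fz; apply: cvg_uniq (cvg_rnorm_shift 1 (op_series S Fz)) _.
rewrite (_ : (fun n => _) =
    fun n => S (a 0%N) + z *: series (fun n => z ^+ n *: a n) n).
  by apply: cvg_add (cvg_const _) _; exact: cvg_scale.
apply/funext => n; rewrite addn1 !seriesES big_ord_recl expr0 scale1r.
congr (_ + _); rewrite scaler_sumr; apply: eq_bigr => k _.
have SZ (x : C) v : S (x *: v) = x *: S v by exact: linearZ.
by rewrite SZ (_ : S (a (lift ord0 k)) = a k) ?scalerA -?exprS //; exact: Sa.
Qed.

Lemma chain_eigenvectors (S : bounded_op V V) :
  a 0%N != 0 -> S (a 0%N) = 0 -> (forall n, S (a n.+1) = a n) ->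
  exists2 r : R, 0 < r & exists F : C -> V, forall z : C, rnorm z < r ->
    [/\ analytic_at F z, S (F z) = z *: F z & F z != 0].
Proof.
move=> a0 Sa0 Sa; have [F FP] := power_series_sum.
have Fan z : rnorm z < (4 * d)^-1 -> analytic_at F z.
  move=> zr; apply: power_series_analytic FP _ _.
  by rewrite -ltr_pdivlMr // -invfM.
have r0 : 0 < (4 * d)^-1 by rewrite invr_gt0 mulr_gt0.
(* F is nonzero at 0, and continuity keeps it nonzero on the disc of radius [e] chosen below. *)
have F0 : F 0 = a 0%N.
  have h0 : series (fun n => (0 : C) ^+ n *: a n) @ \oo --> F 0.
    by apply: FP; rewrite rnorm0 mul0r invr_ge0.
  apply: cvg_uniq (cvg_rnorm_shift 1 h0) _.
  rewrite (_ : (fun n => _) = fun=> a 0%N); first exact: cvg_const.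
  apply/funext => n; rewrite addn1 seriesES big_ord_recl expr0 scale1r.
  by rewrite big1 ?addr0 // => k _; rewrite exprS mul0r scale0r.
have an0 : 0 < rnorm (a 0%N) by rewrite rnorm_gt0.
have F_an0 : analytic_at F 0 by apply: Fan; rewrite rnorm0.
have [e e0 h] := analytic_continuous F_an0 an0.
exists (Num.min (4 * d)^-1 e); first by rewrite lt_min r0 e0.
exists F => z; rewrite lt_min => /andP[zr ze]; split; first exact: Fan.
  rewrite (chain_sum Sa) ?Sa0 ?add0r //; apply: FP.
  have zd : rnorm z * d < 4^-1 by rewrite -ltr_pdivlMr // -invfM.
  by apply: le_trans (ltW zd) _; rewrite lef_pV2 ?posrE // ler_nat.
apply/eqP => Fz; have := h z; rewrite subr0 => /(_ ze).
by rewrite Fz F0 sub0r rnormN ltxx.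
Qed.

End Chains.

(** * Operators and their resolvents *)

Section Operators.
Context {R : realType}.
Notation C := (Cplx R).
Implicit Types V W Y Z : normedModType C.

Lemma surjectiveP Y (S : bounded_op Y Y) :
  surjective_op S <-> forall y, exists x, S x = y.
Proof.
split=> [SY y|h]; last first.
  by apply/seteqP; split=> // y _; have [x <-] := h y; exists x.
have [x _ <-] : range S y by rewrite (SY : range S = setT).
by exists x.
Qed.

Lemma small_lt (r : R) : 0 < r -> exists2 z : C, z != 0 & rnorm z < r.
Proof.
move=> r0; have r2 : 0 < r / 2 by rewrite divr_gt0.
exists (toC (r / 2)); first by rewrite -rnorm_gt0 rnorm_toC gtr0_norm.
by rewrite rnorm_toC gtr0_norm // ltr_pdivrMr // ltr_pMr // ltr1n.
Qed.

Lemma opZ V W (f : bounded_op V W) (c : C) x : f (c *: x) = c *: f x.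
Proof. exact: linearZ. Qed.

Lemma opB V W (f : bounded_op V W) x y : f (x - y) = f x - f y.
Proof. exact: linearB. Qed.

Lemma opD V W (f : bounded_op V W) x y : f (x + y) = f x + f y.
Proof. exact: linearD. Qed.

Lemma op_expSr Y (S : bounded_op Y Y) n x : op_exp S n.+1 x = op_exp S n (S x).
Proof. by elim: n => //= n IH; rewrite -IH. Qed.

Lemma op_expD Y (S : bounded_op Y Y) m n x :
  op_exp S (m + n) x = op_exp S m (op_exp S n x).
Proof. by elim: m => //= m IH; rewrite IH. Qed.

(* Neumann series along a chain of bounded preimages of y. *)
Lemma surjective_perturbation Y (S : bounded_op Y Y) :
  banach Y -> surjective_op S ->
  exists2 r : R, 0 < r & forall z : C, rnorm z < r ->
    surjective_op (S - z *: op_id).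
Proof.
move=> bY /surjectiveP/(open_mapping bY bY)[c c0 h].
have /choice[g gP] : forall w, exists y, S y = w /\ rnorm y <= c * rnorm w.
  by move=> w; have [y] := h w; exists y.
have d0 : 0 < c + 1 by rewrite ltr_wpDl.
exists (2 * (c + 1))^-1 => [|z zr]; first by rewrite invr_gt0 mulr_gt0.
(* The chain starts at [g y] rather than y, so that [S (a 0) = y]. *)
apply/surjectiveP => y; pose a n := iter n.+1 g y.
have a_le n : rnorm (a n) <= ((c + 1) * rnorm y) * (c + 1) ^+ n.
  elim: n => [|n IH].
    rewrite expr0 mulr1; apply: le_trans (gP _).2 _.
    by rewrite ler_wpM2r ?rnorm_ge0 // lerDl.
  rewrite exprSr mulrA [leRHS]mulrC; apply: le_trans (gP _).2 _.
  apply: ler_pM => //; [exact: rnorm_ge0|by rewrite lerDl].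
have [F FP] := power_series_sum bY d0 a_le.
have zd : rnorm z * (c + 1) <= 2^-1.
  by apply: ltW; rewrite -ltr_pdivlMr // -invfM.
have Sa n : S (a n.+1) = a n by exact: (gP _).1.
exists (F z); rewrite -[LHS]/(S (F z) - z *: F z) (chain_sum Sa (FP _ zd)).
rewrite (_ : S (a 0%N) = y); last exact: (gP _).1.
exact: addrK.
Qed.

Lemma closed_dist Y (A : set Y) (y : Y) : closed A -> ~ A y ->
  exists2 d : R, 0 < d & forall x, A x -> d <= rnorm (y - x).
Proof.
move=> cA nAy; have : nbhs y (~` A).
  by apply: open_nbhs_nbhs; split=> //; exact: closed_openC.
move=> /nbhs_rnorm[d d0 h]; exists d => // x Ax.
by rewrite leNgt; apply/negP => lt; apply: (h x) => //; rewrite rnormC.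
Qed.

(** For y at distance d > 0 from the range, S x + b y |-> b has norm at most 1/d, because |S x + b
    y| >= |b| d; Hahn-Banach extends it. *)
Lemma annihilator Y (S : bounded_op Y Y) :
  closed (range S) -> ~ surjective_op S ->
  exists2 phi : dual Y, phi != 0 & forall x, phi (S x) = 0.
Proof.
move=> cS nS; have [y yS] : exists y, ~ range S y.
  apply: contrapT => h; apply/nS/seteqP; split=> // y _.
  by apply: contrapT => yS; apply: h; exists y.
have [d d0 dP] := closed_dist cS yS.
pose G := [set q : Y * C | exists x, q.1 = S x + q.2 *: y].
have dV0 : 0 <= d^-1 by rewrite invr_ge0 ltW.
have [|||phi [phiG _]] := @hahn_banach _ Y d^-1 G dV0.
- by exists 0; rewrite /= linear0 scale0r addr0.
- move=> a u b v b' [x /= ->] [x' /= ->]; exists (a *: x + x') => /=.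
  by rewrite linearP scalerDr scalerDl scalerA addrACA.
- move=> _ b [x /= ->]; rewrite ler_pdivlMl //.
  have [->|b0] := eqVneq b 0; first by rewrite rnorm0 mulr0 rnorm_ge0.
  have -> : S x + b *: y = b *: (y - S (- b^-1 *: x)).
    rewrite opZ scaleNr opprK scalerDr scalerA mulfV // scale1r.
    exact: addrC.
  rewrite rnorm_scale mulrC ler_wpM2l ?rnorm_ge0 //.
  by apply: dP; eexists.
exists phi => [|x]; last by apply: phiG; exists x; rewrite scale0r addr0.
apply/eqP => phi0; have := phiG y 1; rewrite phi0 => h.
have /eqP : (0 : C) = 1 by apply: h; exists 0; rewrite /= linear0 scale1r add0r.
by rewrite eq_sym oner_eq0.
Qed.

(** Since phi kills the kernel, S x |-> phi x may be evaluated at the small preimage of S x; this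
    bounds it on the range of S, from which it is extended. *)
Lemma functional_descent Y (S : bounded_op Y Y) (K : R) (phi : dual Y) :
  0 <= K -> (forall x, exists2 y, S y = S x & rnorm y <= K * rnorm (S x)) ->
  (forall x, S x = 0 -> phi x = 0) ->
  exists psi : dual Y, (forall x, psi (S x) = phi x) /\
    rnorm psi <= rnorm phi * K.
Proof.
move=> K0 lift ker.
have [||||psi [psiG le]] := @hahn_banach _ Y (rnorm phi * K)
  [set q : Y * C | exists2 x, q.1 = S x & q.2 = phi x].
- by rewrite mulr_ge0 ?rnorm_ge0.
- by exists 0; rewrite /= linear0.
- move=> a u b v b' [x /= -> ->] [x' /= -> ->].
  by exists (a *: x + x'); rewrite linearP.
- move=> _ _ [x /= -> ->]; have [y yx le] := lift x.
  have -> : phi x = phi y.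
    apply/eqP; rewrite -subr_eq0 -opB; apply/eqP/ker.
    by rewrite opB yx subrr.
  apply: le_trans (rnorm_op _ _) _; rewrite -mulrA.
  by apply: ler_wpM2l => //; exact: op_norm_ge0.
by exists psi; split=> // x; apply: psiG; exists x.
Qed.

Lemma kato_chain Y (S : bounded_op Y Y) :
  banach Y -> kato S -> ~ surjective_op S ->
  exists (phi : nat -> dual Y) (c d : R),
    [/\ 0 < d, forall n, rnorm (phi n) <= c * d ^+ n, phi 0%N != 0,
        forall x, phi 0%N (S x) = 0 & forall n x, phi n.+1 (S x) = phi n x].
Proof.
move=> bY [cS kS] nS.
have [K K0 lift] := closed_range_lift bY bY cS.
have [phi0 phi0_neq0 phi0S] := annihilator cS nS.
(* The kernel condition stays a premise inside the choice, because it is known of the n-th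
   functional only once the chain has been built up to n. *)
have /choice[g gP] : forall phi : dual Y, exists psi : dual Y,
    (forall x, S x = 0 -> phi x = 0) ->
    (forall x, psi (S x) = phi x) /\ rnorm psi <= rnorm phi * K.
  move=> phi; have [ker|nker] := pselect (forall x, S x = 0 -> phi x = 0).
    by have [psi h] := functional_descent K0 lift ker; exists psi.
  by exists 0.
pose phi n := iter n g phi0.
have phi_ker n : (forall x, phi n (op_exp S n.+1 x) = 0) ->
    forall x, S x = 0 -> phi n x = 0.
  by move=> h x Sx; have [u _ <-] := kS n.+1 x Sx.
(* This identity and the kernel condition advance together: the identity at n makes [phi n] kill the
   kernel, which yields phi_(n+1) o S = phi_n and hence the identity at n + 1. *)
have phi_exp n : forall x, phi n (op_exp S n.+1 x) = 0.
  elim: n => [|n IH] x; first exact: phi0S.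
  have [h _] := gP _ (phi_ker _ IH).
  by rewrite -[LHS]/(g (phi n) (S (op_exp S n.+1 x))) h.
have phiP n := gP _ (phi_ker n (phi_exp n)).
have K1 : 0 < K + 1 by rewrite ltr_wpDl.
exists phi, (rnorm phi0), (K + 1); split=> //; last first.
  by move=> n x; exact: (phiP n).1.
elim=> [|n IH]; first by rewrite expr0 mulr1.
apply: le_trans (phiP n).2 _; rewrite exprSr mulrA.
by apply: ler_pM => //; [exact: rnorm_ge0|rewrite lerDl].
Qed.

Lemma cvg_unshift V (u : nat -> V) (l : V) :
  (fun n => u n.+1) @ \oo --> l -> u @ \oo --> l.
Proof.
move=> /cvg_rnorm h; apply/cvg_rnorm => e /h[n0 hn].
by exists n0.+1 => -[//|n]; exact: hn.
Qed.

(* Comparison of the Laurent coefficients in (Phi - w) (w ^ -m g) = e. *)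
Lemma laurent_coeffs V (Phi : bounded_op V V) (e : V) (m : nat) (g : C -> V)
    (a : nat -> V) (z0 : C) :
  (\forall z \near z0, series (fun n => (z - z0) ^+ n *: a n) @ \oo --> g z) ->
  (\forall z \near z0^', Phi (g z) - (z - z0) *: g z = (z - z0) ^+ m *: e) ->
  forall n, Phi (a n) = (if n is k.+1 then a k else 0) + e *+ (n == m).
Proof.
move=> ga /dnbhs_rnorm[d d0 hd] n; apply/eqP; rewrite -subr_eq0; apply/eqP.
pose a' n := if n is k.+1 then a k else 0.
pose h z := Phi (g z) - (z - z0) *: g z - (z - z0) ^+ m *: e.
apply: (@ps_coeffs_eq0 _ _ (fun n => Phi (a n) - (a' n + e *+ (n == m))) z0 h); last first.
  move=> r r0; have [|w w0 wr] := small_lt (_ : 0 < Num.min d r).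
    by rewrite lt_min d0 r0.
  move: wr; rewrite lt_min => /andP[wd wr].
  have zw : z0 + w - z0 = w by rewrite addrC addKr.
  have zz0 : z0 + w != z0 by rewrite -subr_eq0 zw.
  by exists (z0 + w); split=> //; rewrite ?zw // /h hd ?zw ?subrr.
move: ga => /nbhs_rnorm[r r0 hr]; apply/nbhs_rnorm; exists r => // z /hr gz.
set w := z - z0 in gz *; rewrite /h -/w.
have wgz : series (fun n => w ^+ n *: a' n) @ \oo --> w *: g z.
  apply: cvg_unshift; rewrite (_ : (fun n => _) =
    fun n => w *: series (fun n => w ^+ n *: a n) n); first exact: cvg_scale.
  apply/funext => N; rewrite !seriesES big_ord_recl scaler0 add0r scaler_sumr.
  by apply: eq_bigr => k _; rewrite scalerA -exprS.
have we : series (fun n => w ^+ n *: (e *+ (n == m))) @ \oo --> w ^+ m *: e.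
  apply/cvg_rnorm => eps eps0; exists m.+1 => N mN.
  rewrite seriesES (bigD1 (Ordinal mN)) //= eqxx mulr1n big1 ?addr0 ?subrr ?rnorm0 //.
  by move=> k; rewrite -val_eqE /= => /negPf ->; rewrite mulr0n scaler0.
have := cvg_add (cvg_add (op_series Phi gz) (cvg_scale (-1) wgz)) (cvg_scale (-1) we).
rewrite !scaleN1r; set F1 := (X in X @ _ --> _ -> _).
rewrite (_ : F1 = series (fun n => w ^+ n *: (Phi (a n) - (a' n + e *+ (n == m))))) //.
apply/funext => N; rewrite /F1 !seriesES !scaleN1r -!sumrB; apply: eq_bigr => k _.
by rewrite opZ scalerBr scalerDr opprD addrA.
Qed.

(** * Poles of the resolvent and Drazin invertibility *)

Section Multiplication.
Variables (Z : normedModType C) (A : bounded_op Z Z).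
Local Notation L := (bounded_op Z Z).

Lemma rnorm_comp (X Y W : normedModType C) (g : bounded_op Y W) (f : bounded_op X Y) :
  rnorm (op_comp g f) <= rnorm g * rnorm f.
Proof.
apply: op_norm_bound => [|x]; first by rewrite mulr_ge0 ?rnorm_ge0.
apply: le_trans (rnorm_op g (f x)) _; rewrite -mulrA.
by apply: ler_wpM2l; [exact: op_norm_ge0|exact: rnorm_op].
Qed.

Let lmul_lin : linear (fun B : L => op_comp A B : L).
Proof. by move=> a B B'; apply: opP => x /=; rewrite linearP. Qed.

Let rmul_lin : linear (fun B : L => op_comp B A : L).
Proof. by move=> a B B'; apply: opP. Qed.

Definition op_lmul : bounded_op L L :=
  BoundedOp (bounded_opP lmul_lin (fun B => rnorm_comp A B)).

Let rmul_le (B : L) : rnorm (op_comp B A : L) <= rnorm A * rnorm B.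
Proof. by rewrite mulrC; exact: rnorm_comp. Qed.

Definition op_rmul : bounded_op L L := BoundedOp (bounded_opP rmul_lin rmul_le).

End Multiplication.

(** The relations A^m = A^(m+1) B and A B = B A of a Drazin inverse B; m = 0 covers an invertible
    A. *)
Definition right_drazin_commuting Z (A : bounded_op Z Z) : Prop :=
  exists m (B : bounded_op Z Z),
    (forall x, op_exp A m x = op_exp A m.+1 (B x)) /\
    (forall x, A (B x) = B (A x)).

(** B is the coefficient a_m of g, the constant term of the Laurent expansion of the resolvent.
    Comparing coefficients gives A a_0 = 0, A a_k = a_(k-1) for 0 < k < m and A a_m = a_(m-1) + 1.
    Hence A^m kills a_(m-1) and A^(m+1) a_m = A^m. Expanding both products with the resolvent yields
    A a_m = a_m A. *)
Lemma pole_drazin Z (T : bounded_op Z Z) (l : C) :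
  resolvent_pole T l -> right_drazin_commuting (T - l *: op_id).
Proof.
move=> [m [g [m0 [a ga] _ ginv]]]; set A := T - l *: op_id.
have shift z x : (T - z *: op_id) x = A x - (z - l) *: x.
  rewrite /A -[LHS]/(T x - z *: x) -[A x]/(T x - l *: x).
  by rewrite scalerBl opprB addrA subrK.
have AP : \forall z \near l^',
    op_lmul A (g z) - (z - l) *: g z = (z - l) ^+ m *: op_id.
  have [d d0 h] := (dnbhs_rnorm _ _).1 ginv.
  apply/dnbhs_rnorm; exists d => // z zd zl.
  have zl0 : (z - l) ^+ m != 0 by rewrite expf_neq0 // subr_eq0.
  have [inv _] := h z zd zl; apply: opP => x.
  have := congr1 (fun B : bounded_op Z Z => (z - l) ^+ m *: B x) inv.
  rewrite -[op_comp _ _ x]/((T - z *: op_id) ((z - l) ^- m *: g z x)).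
  by rewrite opZ scalerA mulfV // scale1r shift.
have PA : \forall z \near l^',
    op_rmul A (g z) - (z - l) *: g z = (z - l) ^+ m *: op_id.
  have [d d0 h] := (dnbhs_rnorm _ _).1 ginv.
  apply/dnbhs_rnorm; exists d => // z zd zl.
  have zl0 : (z - l) ^+ m != 0 by rewrite expf_neq0 // subr_eq0.
  have [_ inv] := h z zd zl; apply: opP => x.
  have := congr1 (fun B : bounded_op Z Z => (z - l) ^+ m *: B x) inv.
  rewrite -[op_comp _ _ x]/((z - l) ^- m *: g z ((T - z *: op_id) x)).
  by rewrite scalerA mulfV // scale1r shift opB opZ.
have Aa n x : A (a n x) = (if n is k.+1 then a k x else 0) + x *+ (n == m).
  have := congr1 (fun B : bounded_op Z Z => B x) (laurent_coeffs ga AP n).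
  by case: n => [|n] /= ->; case: eqP.
have aA n x : a n (A x) = (if n is k.+1 then a k x else 0) + x *+ (n == m).
  have := congr1 (fun B : bounded_op Z Z => B x) (laurent_coeffs ga PA n).
  by case: n => [|n] /= ->; case: eqP.
have Aan n x : (n < m)%N -> op_exp A n.+1 (a n x) = 0.
  elim: n => [|n IH] nm; rewrite op_expSr Aa ltn_eqF // mulr0n addr0 ?linear0 //.
  by apply: IH; apply: leq_trans nm.
exists m, (a m); split=> x; last by rewrite Aa aA.
rewrite op_expSr Aa eqxx mulr1n opD.
case: m m0 Aan {AP PA Aa aA ginv} => // k _ h.
by rewrite h // add0r.
Qed.

Lemma meromorphic_drazin Z (T : bounded_op Z Z) (l : C) :
  meromorphic T -> l != 0 -> right_drazin_commuting (T - l *: op_id).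
Proof.
move=> mT l0; have [Tl|] := pselect (spectrum T l); first exact/pole_drazin/mT.
move=> /contrapT[B [AB BA]]; exists 0%N, B; split=> x.
  by have := congr1 (fun D : bounded_op Z Z => D x) AB => /= ->.
have /= -> := congr1 (fun D : bounded_op Z Z => D x) AB.
by have /= -> := congr1 (fun D : bounded_op Z Z => D x) BA.
Qed.

Lemma invertible_surjective Z (A B : bounded_op Z Z) :
  is_inverse A B -> surjective_op A.
Proof.
move=> [AB _]; apply/surjectiveP => y; exists (B y).
exact: (congr1 (fun D : bounded_op Z Z => D y) AB).
Qed.

Lemma meromorphic_surjective Z (T : bounded_op Z Z) (l : C) :
  meromorphic T -> l != 0 -> surjective_op (T - l *: op_id) \/
  exists2 d : R, 0 < d & forall z, rnorm (z - l) < d -> z != l ->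
    surjective_op (T - z *: op_id).
Proof.
move=> mT l0; have [/(mT _ l0)[m [g [_ _ _ h]]]|] := pselect (spectrum T l).
  right; have [d d0 hd] := (dnbhs_rnorm _ _).1 h; exists d => // z zd zl.
  exact: invertible_surjective (hd z zd zl).
by move=> /contrapT[B TB]; left; exact: invertible_surjective TB.
Qed.

End Operators.

(** * Direct sums and spectra *)

Section DirectSum.
Context {R : realType}.
Notation C := (Cplx R).
Implicit Types X Y Z : normedModType C.

(* The decomposition of an operator along a topological direct sum, without
   reference to the subspaces. *)
Record direct_sum X Y Z (T : bounded_op X X) (TY : bounded_op Y Y)
    (TZ : bounded_op Z Z) (i : bounded_op Y X) (j : bounded_op Z X)
    (P : bounded_op X Y) (Q : bounded_op X Z) : Prop := DirectSum {
  ds_Pi : forall y, P (i y) = y;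
  ds_Pj : forall z, P (j z) = 0;
  ds_Qi : forall y, Q (i y) = 0;
  ds_Qj : forall z, Q (j z) = z;
  ds_sum : forall x, i (P x) + j (Q x) = x;
  ds_i : forall y, T (i y) = i (TY y);
  ds_j : forall z, T (j z) = j (TZ z) }.

Section Theory.
Variables (X Y Z : normedModType C) (T : bounded_op X X).
Variables (TY : bounded_op Y Y) (TZ : bounded_op Z Z).
Variables (i : bounded_op Y X) (j : bounded_op Z X).
Variables (P : bounded_op X Y) (Q : bounded_op X Z).
Hypothesis ds : direct_sum T TY TZ i j P Q.

Let T_sum x : T x = i (TY (P x)) + j (TZ (Q x)).
Proof. by rewrite -{1}(ds_sum ds x) opD (ds_i ds) (ds_j ds). Qed.

Lemma ds_P x : P (T x) = TY (P x).
Proof. by rewrite T_sum opD (ds_Pi ds) (ds_Pj ds) addr0. Qed.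

Lemma ds_Q x : Q (T x) = TZ (Q x).
Proof. by rewrite T_sum opD (ds_Qi ds) (ds_Qj ds) add0r. Qed.

Lemma ds_shift (l : C) : direct_sum (T - l *: op_id) (TY - l *: op_id)
  (TZ - l *: op_id) i j P Q.
Proof.
case: ds => h1 h2 h3 h4 h5 h6 h7; split=> // y.
  by rewrite opB opZ -h6.
by rewrite opB opZ -h7.
Qed.

Lemma ds_exp n : direct_sum (op_exp T n) (op_exp TY n) (op_exp TZ n) i j P Q.
Proof.
case: ds => h1 h2 h3 h4 h5 h6 h7; split=> // y.
  by elim: n => //= n ->.
by elim: n => //= n ->.
Qed.

Lemma ds_range x y z : TY y = P x -> TZ z = Q x -> T (i y + j z) = x.
Proof. by move=> yx zx; rewrite opD (ds_i ds) (ds_j ds) yx zx (ds_sum ds). Qed.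

Lemma ds_surjective : surjective_op TY -> surjective_op TZ -> surjective_op T.
Proof.
move=> /surjectiveP sY /surjectiveP sZ; apply/surjectiveP => x.
have [y yx] := sY (P x); have [z zx] := sZ (Q x).
by exists (i y + j z); exact: ds_range.
Qed.

End Theory.

Section Inclusion.
Variables (X : normedModType C) (M : submodClosed X).

Let incl_lin : linear (fun x : subspace_of M => val x).
Proof. by move=> a x y. Qed.

Let incl_le (x : subspace_of M) : rnorm (val x) <= 1 * rnorm x.
Proof. by rewrite mul1r. Qed.

Definition op_incl : bounded_op (subspace_of M) X :=
  BoundedOp (bounded_opP incl_lin incl_le).

End Inclusion.

(** Addition is a bounded bijection from the Banach space M x N onto X. The open mapping theorem
    bounds its inverse [g], whose components are the projections; [g] is linear because addition is
    injective. *)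
Lemma reduces_direct_sum X (T : bounded_op X X) (M N : submodClosed X)
    (TMN : reduces T M N) : banach X ->
  exists P Q, direct_sum T (op_restrict (red_invl TMN))
    (op_restrict (red_invr TMN)) (op_incl M) (op_incl N) P Q.
Proof.
move=> bX; pose E := (subspace_of M * subspace_of N)%type.
pose s (p : E) : X := val p.1 + val p.2.
have s_lin : linear s.
  by move=> a p q; rewrite /s /= scalerDr addrACA.
have s_le p : rnorm (s p) <= 2 * rnorm p.
  apply: le_trans (rnormD _ _) _; rewrite mulr_natl mulr2n.
  apply: lerD; first exact: (@rnorm_fst R (subspace_of M) (subspace_of N) p).
  exact: (@rnorm_snd R (subspace_of M) (subspace_of N) p).
pose S : bounded_op E X := BoundedOp (bounded_opP s_lin s_le).
have S_inj p q : S p = S q -> p = q.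
  case: p q => [u v] [u' v'] /= /eqP; rewrite /s /= -subr_eq0 opprD addrACA addr_eq0.
  move=> /eqP uv; have uM : val (u - u') \in M := valP _.
  have uN : val (u - u') \in N.
    rewrite (_ : val (u - u') = val (v' - v)); first exact: valP.
    by rewrite /= uv opprB.
  have u0 := red_cap TMN uM uN.
  have uu : u = u' by apply: val_inj; apply/eqP; rewrite -subr_eq0; apply/eqP.
  have vv : v = v'.
    apply: val_inj; apply/eqP; rewrite -subr_eq0 -oppr_eq0 -uv; apply/eqP.
    exact: u0.
  by rewrite uu vv.
have bE : banach E.
  apply: banach_prod; apply: banach_closed bX _.
    exact: red_closedl TMN.
  exact: red_closedr TMN.
have [|c c0 h] := open_mapping (f := S) bE bX.
  move=> x; have [u [v [uM vN ->]]] := red_sum TMN x.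
  by exists (Subspace uM, Subspace vN).
have /choice[g gP] : forall x, exists p, S p = x /\ rnorm p <= c * rnorm x.
  by move=> x; have [p] := h x; exists p.
have g_lin : linear g.
  move=> a x y; apply: S_inj; rewrite (gP _).1 opD opZ.
  by rewrite (gP x).1 (gP y).1.
have gS p : g (S p) = p by apply: S_inj; exact: (gP _).1.
have P_lin : linear (fun x => (g x).1) by move=> a x y; rewrite g_lin.
have Q_lin : linear (fun x => (g x).2) by move=> a x y; rewrite g_lin.
have P_le x : rnorm (g x).1 <= c * rnorm x.
  exact: le_trans (rnorm_fst _) (gP x).2.
have Q_le x : rnorm (g x).2 <= c * rnorm x.
  exact: le_trans (rnorm_snd _) (gP x).2.
exists (BoundedOp (bounded_opP P_lin P_le)), (BoundedOp (bounded_opP Q_lin Q_le)).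
have gi (u : subspace_of M) : g (val u) = (u, 0).
  by rewrite -[RHS]gS; congr g; rewrite /= /s /= addr0.
have gj (v : subspace_of N) : g (val v) = (0, v).
  by rewrite -[RHS]gS; congr g; rewrite /= /s /= add0r.
split=> //= [y|z|y|z|x]; rewrite ?gi ?gj //.
exact: (gP x).1.
Qed.

End DirectSum.

(** * Lower semi-B-Browder operators and descent *)

Section SemiBrowder.
Context {R : realType}.
Notation C := (Cplx R).
Implicit Types X Y Z : normedModType C.

Lemma surjective_finite_descent Y (S : bounded_op Y Y) :
  surjective_op S -> finite_descent S.
Proof.
move=> /surjectiveP sS; exists 0%N; apply/seteqP; split=> y _.
  by have [x <-] := sS y; exists x.
by exists y.
Qed.

Lemma surjective_semi_browder Y (S : bounded_op Y Y) :
  surjective_op S -> lower_semi_browder S.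
Proof.
move=> sS; split; last exact: surjective_finite_descent.
exists 0%N, (fun=> 0) => y; exists (fun=> 0).
by rewrite big_ord0 subr0 (sS : range S = setT).
Qed.

Lemma semi_b_browder_intro Y (S : bounded_op Y Y) m :
  closed (range (op_exp S m)) ->
  (forall x, exists y, op_exp S m x = op_exp S m.+1 y) ->
  lower_semi_b_browder S.
Proof.
move=> cS dS; exists m; split=> //; apply: surjective_semi_browder.
apply/surjectiveP => -[w wS]; have [x _ xw] := set_mem wS.
have [y yx] := dS x.
have yS : op_exp S m y \in op_range (op_exp S m) by apply/mem_set; exists y.
by exists (Subspace yS); apply: val_inj; rewrite /= -xw yx.
Qed.

(** The range of S^(k+n) is the range of the k-th power of the restriction to R(S^n), so
    stabilization at k for the restriction is stabilization at k + n for S. *)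
Lemma semi_b_browder_finite_descent Y (S : bounded_op Y Y) :
  lower_semi_b_browder S -> finite_descent S.
Proof.
move=> [n [_ [_ [k hk]]]]; set W := op_restrict _ in hk.
have WE p w : val (op_exp W p w) = op_exp S p (val w).
  by elim: p => //= p ->.
exists (k + n)%N; apply/seteqP; split=> _ [x _ <-]; last first.
  by exists (S x) => //; rewrite -op_expSr.
have xS : op_exp S n x \in op_range (op_exp S n) by apply/mem_set; exists x.
have [w' _ ww'] : range (op_exp W k.+1) (op_exp W k (Subspace xS)).
  by rewrite -hk; exists (Subspace xS).
have [x' _ x'w] := set_mem (valP w').
exists x' => //; rewrite -addSn op_expD x'w -WE ww' WE.
by rewrite op_expD.
Qed.

Lemma closed_kernel X Y (f : bounded_op X Y) : closed [set x | f x = 0].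
Proof.
rewrite (_ : [set x | f x = 0] = f @^-1` [set 0]) //.
apply: preimage_closed => [x _|]; first exact: op_continuous.
exact/accessible_closed_set1/hausdorff_accessible/norm_hausdorff.
Qed.

(* If A^m = A^(m+1) B with B commuting with A, then A^m B^m is a projection
   onto the range of A^m, which is therefore closed. *)
Lemma drazin_semi_b_browder X Y Z (T : bounded_op X X) (TY : bounded_op Y Y)
    (TZ : bounded_op Z Z) i j P Q :
  direct_sum T TY TZ i j P Q -> surjective_op TY ->
  right_drazin_commuting TZ -> lower_semi_b_browder T.
Proof.
move=> ds /surjectiveP sY [m [B [BP BC]]].
have sYn n : forall y, exists x, op_exp TY n x = y.
  elim: n => [|n IH] y; first by exists y.
  by have [x xy] := sY y; have [u ux] := IH x; exists u; rewrite /= ux.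
have BCn n x : op_exp TZ n (B x) = B (op_exp TZ n x).
  by elim: n => //= n ->; rewrite BC.
have BnC n k x : op_exp TZ n (op_exp B k x) = op_exp B k (op_exp TZ n x).
  by elim: k => //= k IH; rewrite BCn IH.
have BPk k : forall x, op_exp TZ m x = op_exp TZ (k + m) (op_exp B k x).
  elim: k => [|k IH] x //; rewrite BP [RHS]/= -[op_exp TZ m.+1 _]/(TZ _) IH.
  by rewrite -(op_expSr B k x).
(* Powers of TY are onto, so membership in the range of T^m constrains only the Z-component, which
   must be fixed by the projection; the range is thus the kernel of the bounded operator D. *)
pose D := op_comp (op_comp (op_exp TZ m) (op_exp B m)) Q - Q.
have rangeE : range (op_exp T m) = [set x | D x = 0].
  have DE u : D u = op_exp TZ m (op_exp B m (Q u)) - Q u by [].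
  have dsm := ds_exp ds m; apply/seteqP; split=> [_ [x _ <-]|x xD0].
    suff : D (op_exp T m x) = 0 by [].
    by rewrite DE (ds_Q dsm) -BnC -op_expD -BPk subrr.
  have /eqP := xD0 : D x = 0; rewrite DE subr_eq0 => /eqP xD.
  have [y yx] := sYn m (P x).
  by eexists; [|exact: (ds_range dsm yx xD)].
apply: (@semi_b_browder_intro _ _ m).
  by rewrite rangeE; exact: closed_kernel.
move=> x; have dsm := ds_exp ds m; have dsS := ds_exp ds m.+1.
have [y yx] := sYn m.+1 (P (op_exp T m x)).
have zx : op_exp TZ m.+1 (B (Q x)) = Q (op_exp T m x) by rewrite (ds_Q dsm) BP.
by exists (i y + j (B (Q x))); rewrite (ds_range dsS yx zx).
Qed.

End SemiBrowder.

(** * Surjective and B-Browder spectra near 0, and the SVEP of the dual *)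

Section Spectral.
Context {R : realType}.
Notation C := (Cplx R).

Lemma op_shiftE (X : normedModType C) (T : bounded_op X X) (z : C) x :
  (T - z *: op_id) x = T x - z *: x.
Proof. by []. Qed.

Lemma dual_opE (X : normedModType C) (T : bounded_op X X) (phi : dual X) x :
  dual_op T phi x = phi (T x).
Proof. by []. Qed.

Lemma dual_scaleE (X : normedModType C) (z : C) (phi : dual X) x :
  (z *: phi) x = z * phi x.
Proof. by []. Qed.

Variables (X Y Z : normedModType C) (T : bounded_op X X).
Variables (TY : bounded_op Y Y) (TZ : bounded_op Z Z).
Variables (i : bounded_op Y X) (j : bounded_op Z X).
Variables (P : bounded_op X Y) (Q : bounded_op X Z).
Hypotheses (ds : direct_sum T TY TZ i j P Q) (bY : banach Y).

Section Eigenfunctionals.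
Variables (r : R) (F : C -> dual X).
Hypothesis r0 : 0 < r.
Hypothesis FP : forall z : C, rnorm z < r ->
  [/\ analytic_at F z, dual_op T (F z) = z *: F z & F z != 0].

Let F_shift (z l : C) n x : rnorm z < r ->
  F z (op_exp (T - l *: op_id) n x) = (z - l) ^+ n * F z x.
Proof.
move=> /FP[_ TF _]; elim: n x => [|n IH] x; first by rewrite mul1r.
pose y := op_exp (T - l *: op_id) n x.
rewrite exprS -mulrA -IH -[op_exp _ n.+1 x]/((T - l *: op_id) y) -/y.
have Ty : F z (T y) = z * F z y by rewrite -dual_opE TF dual_scaleE.
by rewrite op_shiftE opB opZ Ty mulrBl.
Qed.

(* If (T - l)^n x = (T - l)^(n+1) y, then F z x = (z - l) F z y for z != l,
   and z -> l gives F l x = 0. *)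
Lemma eigenfunctionals_descent (l : C) :
  rnorm l < r -> ~ finite_descent (T - l *: op_id).
Proof.
move=> lr [n hn]; have [Fl _ /eqP] := FP lr; apply; apply: opP => x.
have [y _ yx] : range (op_exp (T - l *: op_id) n.+1)
    (op_exp (T - l *: op_id) n x) by rewrite -hn; exists x.
have Fxy z : rnorm z < r -> z != l -> F z x = (z - l) * F z y.
  move=> zr zl; have := congr1 (F z) yx; rewrite !F_shift // exprSr -mulrA.
  by move/(mulfI (expf_neq0 n _)) => <- //; rewrite subr_eq0.
apply/rnorm0_eq0/eqP; rewrite eq_le rnorm_ge0 andbT; apply: le_eps0 => e e0.
(* K collects the factors in |F l x| <= |(F l - F z) x| + |z - l| |F z| |y|, where |F z| <= |F l| +
   1 near l; the last summand makes it positive. *)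
pose K := rnorm x + (rnorm (F l) + 1) * rnorm y + 1.
have K0 : 0 < K.
  by rewrite ltr_wpDl // addr_ge0 ?mulr_ge0 ?addr_ge0 ?rnorm_ge0.
have e1 : 0 < Num.min 1 (e / K) by rewrite lt_min ltr01 divr_gt0.
have [d d0 hd] := analytic_continuous Fl e1.
have : 0 < Num.min (Num.min d (r - rnorm l)) (e / K).
  by rewrite !lt_min d0 subr_gt0 lr divr_gt0.
move=> /small_lt[w w0]; rewrite !lt_min -andbA => /and3P[wd wr we].
have zl : l + w - l = w by rewrite addrC addKr.
have := hd (l + w); rewrite zl => /(_ wd); rewrite lt_min => /andP[F1 F2].
have zr : rnorm (l + w) < r.
  by apply: le_lt_trans (rnormD _ _) _; rewrite addrC -ltrBrDr.
have zl0 : l + w != l by rewrite -subr_eq0 zl.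
have Fw : rnorm (F (l + w)) <= rnorm (F l) + 1.
  rewrite -[F (l + w)](subrK (F l)) addrC.
  by apply: le_trans (rnormD _ _) _; rewrite lerD2l ltW.
have h1 : rnorm (F l x - F (l + w) x) <= e / K * rnorm x.
  rewrite rnormC; apply: le_trans (rnorm_op (F (l + w) - F l) x) _.
  by rewrite ler_wpM2r ?rnorm_ge0 // ltW.
have h2 : rnorm (F (l + w) x) <= e / K * ((rnorm (F l) + 1) * rnorm y).
  rewrite Fxy // zl rnormM; apply: ler_pM; [exact: rnorm_ge0|exact: rnorm_ge0|exact: ltW|].
  apply: le_trans (rnorm_op _ _) _.
  by rewrite ler_wpM2r ?rnorm_ge0.
rewrite -[F l x](subrK (F (l + w) x)).
apply: le_trans (rnormD _ _) _; apply: le_trans (lerD h1 h2) _.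
rewrite -mulrDr -[leRHS](divfK (lt0r_neq0 K0)) ler_wpM2l ?divr_ge0 ?ltW //.
by rewrite /K ltrDl.
Qed.

Lemma eigenfunctionals_svep : ~ svep_at (dual_op T) 0.
Proof.
move=> /(_ (toC r) F); rewrite toC_gt0 => /(_ r0).
have br z : ball (0 : C) (toC r) z -> rnorm z < r.
  by move/ball_rnorm; rewrite subr0.
have F0 : rnorm (0 : C) < r by rewrite rnorm0.
move=> h; have [_ _ /eqP] := FP F0; apply; apply: h; last 1 first.
- by apply/ball_rnorm; rewrite subrr rnorm0.
- by move=> z /br /FP[].
- move=> z /br /FP[_ Fz _].
  by rewrite -[LHS]/(dual_op T (F z) - z *: F z) Fz subrr.
Qed.

End Eigenfunctionals.

(** P intertwines T and TY, so composing with P turns the chain on Y into one for [dual_op T];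
    composing back with i shows that its first element is nonzero. *)
Lemma kato_eigenfunctionals : kato TY -> ~ surjective_op TY ->
  exists2 r : R, 0 < r & exists F : C -> dual X, forall z : C, rnorm z < r ->
    [/\ analytic_at F z, dual_op T (F z) = z *: F z & F z != 0].
Proof.
move=> kTY nTY; have [phi [c [d h]]] := kato_chain bY kTY nTY.
have [d0 phi_le phi0 phiS phiSS] := h.
pose a n : dual X := op_comp (phi n) P.
have bD : banach (dual X) by apply: banach_op; exact: banach_C.
have a_le n : rnorm (a n) <= (c * rnorm P) * d ^+ n.
  rewrite mulrAC; apply: le_trans (rnorm_comp _ _) _.
  by rewrite ler_wpM2r ?rnorm_ge0.
apply: (chain_eigenvectors bD d0 a_le) => [||n].
- apply/eqP => a0; move/eqP: phi0; apply; apply: opP => y.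
  have := congr1 (fun f : dual X => f (i y)) a0.
  by rewrite /= (ds_Pi ds).
- by apply: opP => x; rewrite /= (ds_P ds) phiS.
- by apply: opP => x; rewrite /= (ds_P ds) phiSS.
Qed.

Section Surjective.
Hypotheses (sTY : surjective_op TY) (mTZ : meromorphic TZ).

(** Every small z != 0 is at worst an isolated exception to surjectivity. The second radius is cut
    to r - |z| so that TY - w stays surjective near z. *)
Let near_surjective : exists2 r : R, 0 < r & forall z : C, rnorm z < r ->
  z != 0 -> surjective_op (T - z *: op_id) \/
    exists2 d : R, 0 < d & forall w, rnorm (w - z) < d -> w != z ->
      surjective_op (T - w *: op_id).
Proof.
have [r r0 hr] := surjective_perturbation bY sTY.
exists r => // z zr z0; have [sz|[d d0 hd]] := meromorphic_surjective mTZ z0.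
  by left; apply: ds_surjective (ds_shift ds z) (hr _ zr) sz.
right; exists (Num.min d (r - rnorm z)); first by rewrite lt_min d0 subr_gt0.
move=> w; rewrite lt_min => /andP[wd wr] wz.
apply: ds_surjective (ds_shift ds w) _ (hd w wd wz); apply: hr.
rewrite -[w](subrK z); apply: le_lt_trans (rnormD _ _) _.
by rewrite -ltrBrDr.
Qed.

Lemma surjective_spectrum_interior : ~ interior (surjective_spectrum T) 0.
Proof.
move=> /nbhs_rnorm[s s0 hs]; have [r r0 hr] := near_surjective.
have [|z z0] := small_lt (_ : 0 < Num.min r s); first by rewrite lt_min r0 s0.
rewrite lt_min => /andP[zr zs].
have {}hs (w : C) : rnorm w < s -> ~ surjective_op (T - w *: op_id).
  by move=> ws; apply: hs; rewrite subr0.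
have [|[d d0 hd]] := hr z zr z0; first exact: hs.
have [|w w0] := small_lt (_ : 0 < Num.min d (s - rnorm z)).
  by rewrite lt_min d0 subr_gt0.
rewrite lt_min => /andP[wd ws].
have zw : z + w - z = w by rewrite addrC addKr.
apply: (hs (z + w)); last first.
  by apply: hd; [rewrite zw|rewrite -subr_eq0 zw].
apply: le_lt_trans (rnormD _ _) _.
by rewrite addrC -ltrBrDr.
Qed.

(** [f w] annihilates the range of T - w, so it is 0 where T - w is onto. Near an isolated exception
    w such points cluster, and the identity principle gives f w = 0 as well. The zeros then cluster
    at 0, and [analytic_eq0_ball] spreads the vanishing to the whole disc. *)
Lemma dual_svep : svep_at (dual_op T) 0.
Proof.
move=> rC f /gt0_toC[-> rho0] fa fT z /ball_rnorm; rewrite subr0.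
set rho := reC rC in rho0 fa fT *.
have rhoP (w : C) : rnorm w < rho -> ball (0 : C) (toC rho) w.
  by move=> wr; apply/ball_rnorm; rewrite subr0.
have [r r0 hr] := near_surjective.
have f_surj (w : C) : rnorm w < rho -> surjective_op (T - w *: op_id) -> f w = 0.
  move=> /rhoP/fT fw /surjectiveP sw; apply: opP => x; have [y <-] := sw x.
  have := congr1 (fun g : dual X => g y) fw.
  rewrite -[LHS]/(f w (T y) - w *: f w y) => fwy.
  by rewrite -[(T - _) y]/(T y - w *: y) opB opZ.
have an (w : C) : rnorm w < rho -> analytic_at f w by move=> /rhoP/fa.
have f_punct (w : C) : rnorm w < r -> rnorm w < rho -> w != 0 -> f w = 0.
  move=> wr wrho w0; have [|[d d0 hd]] := hr w wr w0; first exact: f_surj.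
  have [|e e0 he] := identity_principle (an w wrho); last first.
    by apply: he; rewrite subrr rnorm0.
  move=> e e0; have [|v v0] := small_lt (_ : 0 < Num.min (Num.min d e) (rho - rnorm w)).
    by rewrite !lt_min d0 e0 subr_gt0.
  rewrite !lt_min -andbA => /and3P[vd ve vr].
  have vw : w + v - w = v by rewrite addrC addKr.
  have ww : w + v != w by rewrite -subr_eq0 vw.
  exists (w + v); rewrite vw; split=> //; apply: f_surj; last first.
    by apply: hd; rewrite ?vw.
  by apply: le_lt_trans (rnormD _ _) _; rewrite addrC -ltrBrDr.
have f_acc : zeros_cluster f 0.
  move=> e e0; have [|v v0] := small_lt (_ : 0 < Num.min (Num.min r rho) e).
    by rewrite !lt_min r0 rho0.
  rewrite !lt_min -andbA => /and3P[vr vrho ve].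
  by exists v; rewrite subr0; split=> //; exact: f_punct.
have [|d d0 hd] := identity_principle _ f_acc; first by apply: an; rewrite rnorm0.
move=> zr; apply: (analytic_eq0_ball an _ zr).
by exists d => // w wd; apply: hd; rewrite subr0.
Qed.

Lemma semi_b_browder_limit_point :
  ~ limit_point (lower_semi_b_browder_spectrum T) 0.
Proof.
have [r r0 hr] := surjective_perturbation bY sTY.
have nr : nbhs (0 : C) [set z | rnorm z < r].
  by apply/nbhs_rnorm; exists r => // z; rewrite subr0.
move=> /(_ _ nr)[z [z0 nz zr]]; apply: nz.
apply: drazin_semi_b_browder (ds_shift ds z) (hr z zr) _.
exact: meromorphic_drazin.
Qed.

End Surjective.
End Spectral.

(** * The equivalences *)

Lemma surjective_kato (R : realType) (Y : normedModType (Cplx R))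
    (S : bounded_op Y Y) : surjective_op S -> kato S.
Proof.
move=> sS; split; first by rewrite (sS : range S = setT); exact: closedT.
move=> n x _; elim: n x => [|n IH] x; first by exists x.
have [y <-] := (surjectiveP S).1 sS x; have [u _ <-] := IH y.
by exists u.
Qed.

Theorem theorem2p6 (R : realType) (X : completeNormedModType (Cplx R))
    (T : bounded_op X X) (X_infinite_dim : ~ finite_dim X) :
  [<-> exists (M N : submodClosed X) (TMN : reduces T M N),
         surjective_op (op_restrict (red_invl TMN)) /\
         meromorphic (op_restrict (red_invr TMN));
       generalized_kato_meromorphic T /\
         ~ interior (surjective_spectrum T) 0;
       generalized_kato_meromorphic T /\ svep_at (dual_op T) 0;
       generalized_kato_meromorphic T /\
         ~ limit_point (lower_semi_b_browder_spectrum T) 0;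
       generalized_kato_meromorphic T /\
         ~ interior (lower_semi_b_browder_spectrum T) 0].
Proof.
have bX : banach X by exact: complete_banach.
have bM (M : submodClosed X) : closed [set` M] -> banach (subspace_of M).
  exact: banach_closed.
set c1 := (X in [<-> X; _; _; _; _]).
have c1_gkm : c1 -> generalized_kato_meromorphic T.
  move=> [M [N [TMN [sT mT]]]]; exists M, N, TMN; split=> //.
  exact: surjective_kato.
have gkm_c1 : generalized_kato_meromorphic T ->
    (forall (r : R) (F : Cplx R -> dual X), 0 < r ->
      (forall z : Cplx R, rnorm z < r ->
        [/\ analytic_at F z, dual_op T (F z) = z *: F z & F z != 0]) -> False) ->
    c1.
  move=> [M [N [TMN [kT mT]]]] noF; exists M, N, TMN; split=> //.
  apply: contrapT => nsT; have [P [Q ds]] := reduces_direct_sum TMN bX.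
  have [r r0 [F FP]] := kato_eigenfunctionals ds (bM _ (red_closedl TMN)) kT nsT.
  exact: noF r0 FP.
(* One argument for both spectra: eigenfunctionals on a disc give infinite descent at each of its
   points, which places the disc inside A. *)
have spectrum_c1 (A : set (Cplx R)) : generalized_kato_meromorphic T ->
    (forall l : Cplx R, ~ A l -> finite_descent (T - l *: op_id)) ->
    ~ interior A 0 -> c1.
  move=> gT dA nA; apply: gkm_c1 gT _ => r F r0 FP; apply: nA.
  apply/nbhs_rnorm; exists r => // l; rewrite subr0 => lr.
  by apply: contrapT => /dA; exact: (eigenfunctionals_descent FP lr).
tfae.
- move=> c1P; split; first exact: c1_gkm.
  have [M [N [TMN [sT mT]]]] := c1P; have [P [Q ds]] := reduces_direct_sum TMN bX.
  exact: surjective_spectrum_interior ds (bM _ (red_closedl TMN)) sT mT.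
- move=> [gT nint].
  have c1P : c1.
    apply: spectrum_c1 gT _ nint => l /contrapT.
    exact: surjective_finite_descent.
  split=> //; have [M [N [TMN [sT mT]]]] := c1P.
  have [P [Q ds]] := reduces_direct_sum TMN bX.
  exact: dual_svep ds (bM _ (red_closedl TMN)) sT mT.
- move=> [gT svep]; have c1P : c1.
    by apply: gkm_c1 gT _ => r F r0 FP; exact: eigenfunctionals_svep r0 FP svep.
  split=> //; have [M [N [TMN [sT mT]]]] := c1P.
  have [P [Q ds]] := reduces_direct_sum TMN bX.
  exact: semi_b_browder_limit_point ds (bM _ (red_closedl TMN)) sT mT.
(* An interior point of a set in the complex plane is an accumulation point, since each of its
   neighbourhoods contains a further point of the set. *)
- move=> [gT nlim]; split=> // iT; apply: nlim => U.
  move=> /(filterI iT)/nbhs_rnorm[r r0 h]; have [z z0 zr] := small_lt r0.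
  by have [|Az Uz] := h z; [rewrite subr0|exists z].
- move=> [gT nint]; apply: spectrum_c1 gT _ nint => l /contrapT.
  exact: semi_b_browder_finite_descent.
Qed.
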